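(* Let $Q$ be a non-negative symmetric real $N\times N$ matrix and $B$ a real $N\times N$ matrix such that $\operatorname{rank}[Q,BQ,\ldots,B^{N-1}Q]=N$. Let $$\mathcal{K}_0=\tfrac12\operatorname{tr}(QD^2)+\langle Bx,\nabla\rangle .$$ Let $v:\mathbb{R}^N\to\mathbb{R}$ be a non-negative $C^2$-function such that $\mathcal{K}_0v\le 0$ on $\mathbb{R}^N$. Then $v$ is constant if the following condition holds: the real Jordan representation of $B$ is $$\begin{pmatrix}B_0&0\\0&B_1\end{pmatrix},$$ where $B_0$ is stable and $B_1$ is at most of dimension $2$ and of the form $B_1=[0]$ or $B_1=\begin{pmatrix}0&-\alpha\\ \alpha&0\end{pmatrix}$ for some $\alpha\in\mathbb{R}$ (in this last case $N\ge2$ is needed).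
   Context: $D^2 v$ is the Hessian of $v$, so $\mathcal{K}_0v(x)=\tfrac12\operatorname{tr}(QD^2v(x))+\langle Bx,\nabla v(x)\rangle$. $[Q,BQ,\ldots,B^{N-1}Q]$ is the $N\times N^2$ block matrix. A real matrix is stable if all its eigenvalues have negative real part. The real Jordan representation is taken up to similarity by an invertible real matrix; the block $B_0$ may be absent (e.g. the $2\times2$ zero matrix $B$ satisfies the condition with $\alpha=0$). *)

(* Defs.v *)
From HB Require Import structures.
From mathcomp Require Import all_boot all_order all_algebra.
From mathcomp Require Import all_classical all_reals all_analysis.
From mathcomp Require Import complex.

Set Implicit Arguments.
Unset Strict Implicit.
Unset Printing Implicit Defensive.

Import Order.TTheory GRing.Theory Num.Theory.
Import numFieldNormedType.Exports.

Local Open Scope ring_scope.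
Local Open Scope complex_scope.

Definition nonneg_symmetric (R : realType) n (Q : 'M[R]_n) : Prop :=
  Q^T = Q /\ forall x : 'cV[R]_n, 0 <= (x^T *m Q *m x) 0 0.

(* The block matrix [Q, BQ, ..., B^(N-1) Q] with N = n.+1; its width is the
   sum of N copies of N. *)
Definition kalman_mx (R : realType) n (Q B : 'M[R]_n.+1) :=
  \mxrow_(k < n.+1) (B ^+ k *m Q).

(* The space is R^N with N = n.+1, because only matrix types of positive
   dimensions carry the library's normed module structure. *)
Definition partial (R : realType) n (i : 'I_n.+1) (f : 'cV[R]_n.+1 -> R) :
    'cV[R]_n.+1 -> R :=
  fun x => 'D_(delta_mx i 0) f x.

Definition is_C1 (R : realType) n (f : 'cV[R]_n.+1 -> R) : Prop :=
  continuous f /\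
  forall i : 'I_n.+1,
    (forall x, derivable f x (delta_mx i 0)) /\ continuous (partial i f).

Definition is_C2 (R : realType) n (f : 'cV[R]_n.+1 -> R) : Prop :=
  is_C1 f /\ forall i : 'I_n.+1, is_C1 (partial i f).

Definition gradient (R : realType) n (f : 'cV[R]_n.+1 -> R)
    (x : 'cV[R]_n.+1) : 'cV[R]_n.+1 :=
  \col_i partial i f x.

Definition hessian (R : realType) n (f : 'cV[R]_n.+1 -> R)
    (x : 'cV[R]_n.+1) : 'M[R]_n.+1 :=
  \matrix_(i, j) partial i (partial j f) x.

Definition inner (R : realType) n (x y : 'cV[R]_n) : R :=
  \sum_i x i 0 * y i 0.

Definition OU_operator (R : realType) n (Q B : 'M[R]_n.+1)
    (f : 'cV[R]_n.+1 -> R) (x : 'cV[R]_n.+1) : R :=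
  2^-1 * \tr (Q *m hessian f x) + inner (B *m x) (gradient f x).

Definition stable_mx (R : realType) n (A : 'M[R]_n) : Prop :=
  forall z : R[i], eigenvalue (map_mx (real_complex R) A) z -> complex.Re z < 0.

Definition rotation_generator (R : realType) (a : R) : 'M[R]_2 :=
  (block_mx 0 (- a)%:M a%:M 0 : 'M[R]_(1 + 1)).

(* "At most of dimension 2" includes dimension 0, where the block is absent. *)
Inductive critical_block (R : realType) : forall m : nat, 'M[R]_m -> Prop :=
| critical_absent (A : 'M[R]_0) : critical_block A
| critical_zero : critical_block (0 : 'M[R]_1)
| critical_rotation (a : R) : critical_block (rotation_generator a).

(* P B P^-1 = diag(B0, B1); the cast identifies the size k + m of the block
   matrix with the size n of B. The blocks are allowed to be of size 0. *)
Definition recurrent_Jordan (R : realType) n (B : 'M[R]_n) : Prop :=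
  exists (k m : nat) (e : (k + m)%N = n)
         (B0 : 'M[R]_k) (B1 : 'M[R]_m) (P : 'M[R]_n),
    [/\ P \in unitmx,
        P *m B *m invmx P = castmx (e, e) (block_mx B0 0 0 B1),
        stable_mx B0 & critical_block B1].

(* Main.v *)
Require Import Defs.
From mathcomp Require Import all_boot all_order all_algebra.
From mathcomp Require Import all_classical all_reals all_analysis.
From mathcomp Require Import complex spectral mxred ring lra.
Set Implicit Arguments.
Unset Strict Implicit.
Unset Printing Implicit Defensive.
Import Order.TTheory GRing.Theory Num.Theory.
Import numFieldNormedType.Exports.
Local Open Scope classical_set_scope.
Local Open Scope ring_scope.

(** Two independent facts give the theorem: the supersolution [v] attains its
    minimum ([lyapunov_min]), and a supersolution that attains its minimum is constant
    ([strong_minimum_principle]). The first one needs the condition on the Jordan form,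
    the second one the rank condition.

    Attaining the minimum. If there is a function [W] that tends to infinity at
    infinity and satisfies [K_0 W < 0] outside a compact set, then for every [e > 0]
    the function [v + e W] attains its minimum, at a point where its image under
    [K_0] is non-negative, hence at a point of the compact set; letting [e] tend to 0,
    the minimum of [v] on the compact set is its minimum on the whole space. Write
    [x = (y, z)] with [y] in the stable part and [z] in the neutral part, of dimension at
    most two. On [z] the function [ln |z|^2] is harmonic at the leading order when the
    noise is isotropic and the dimension is two, which is the critical case, and the
    perturbation [- A / |z|^2] makes it a strict supersolution. When the neutral drift
    vanishes the noise in [z] is non-degenerate, by the rank condition, and becomes
    isotropic for a suitable scalar product. When the neutral drift is a rotation the
    noise may even be degenerate in [z], but the rotation averages its anisotropy, and
    the average is realized by a corrector [<C z, z>] solving a linear equation. On [y] a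
    quadratic form that decreases along the drift exists by the theorem of Lyapunov; it
    enters [W] divided by [|z|^4], so that the effect of the noise on it is of the order
    of the strict inequality gained in [z] ([lyap], [exists_lyapunov],
    [recurrent_Jordan_forms]).

    Strong minimum principle. Suppose [v x0 = min v] but [v y > min v]. By the rank
    condition a path [gam] with [gam' = - B gam + Q w] leads from [y] to [x0] in an
    arbitrarily short time [T]; the path is even a polynomial ([controlled_path]).
    Around it moves a narrow Gaussian
    [exp (- lam a(t) |x - gam t|^2 / 2 - kap t) - exp (- lam r^2 / 2)], a subsolution of
    the heat equation of [K_0] that initially lies below a multiple of [v - min v], since
    it is positive only in the ball of radius [r] around [y]. By the parabolic
    comparison principle it stays below. As [kap] is [lam] times the trace of [Q] plus a
    constant that depends only on the path, at the time [T] it is still positive at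
    [x0] if [T] is small and then [lam] is large, which contradicts [v x0 = min v].

    Both parts use maximum principles only through second derivatives along lines: [Q]
    is a sum of dyads [s s^T], and [K_0] is one half of the sum of the second derivatives
    in the directions [s], plus the derivative in the direction [B x]
    ([OU_touching]). *)

(** * Derivatives along arbitrary directions *)

Section DirectionalDerivative.
Variable R : realType.

Lemma is_derive_line (V : normedModType R) (f : V -> R) (x d : V) (t l : R) :
  is_derive (x + t *: d) d f l -> is_derive t 1 (fun s : R => f (x + s *: d)) l.
Proof.
move=> [df vf].
have E : (fun h : R => h^-1 *: (((fun s : R => f (x + s *: d)) \o shift t) (h *: 1)
           - f (x + t *: d))) =
         (fun h : R => h^-1 *: ((f \o shift (x + t *: d)) (h *: d) - f (x + t *: d))).
  apply/funext => h /=; congr (_ *: (f _ - _)).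
  by rewrite [h *: 1]mulr1 scalerDl addrCA addrA.
by split; rewrite /derivable /derive E.
Qed.

Lemma symmetric_MVT (g g' : R -> R) (h : R) :
  (forall t : R, is_derive t 1 g (g' t)) ->
  exists2 c, `|c| <= `|h| & g h - g 0 = g' c * h.
Proof.
move=> dg.
have cg : continuous g.
  by move=> t; apply/differentiable_continuous/derivable1_diffP; case: (dg t).
have [h0|/ltW h0] := leP 0 h.
  have [|c /[!in_itv] /= /andP[c0 ch] E] := @MVT_segment R g g' 0 h h0 (fun x _ => dg x).
    exact: continuous_subspaceT.
  by exists c; rewrite ?E ?subr0 // !ger0_norm // (le_trans c0).
have [|c /[!in_itv] /= /andP[c0 ch] E] := @MVT_segment R g g' h 0 h0 (fun x _ => dg x).
  exact: continuous_subspaceT.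
exists c; first by rewrite !ler0_norm // lerN2.
by rewrite -opprB E; ring.
Qed.

(** One of the two directional derivatives has to be continuous: the mean value
    theorem along [a] moves the base point. *)
Lemma is_derive_dirD (V : normedModType R) (f la : V -> R) (x a b : V) (m : R) :
  (forall y, is_derive y a f (la y)) -> continuous la -> is_derive x b f m ->
  is_derive x (a + b) f (la x + m).
Proof.
move=> dfa ca dfb.
suff H : (fun h : R => h^-1 *: ((f \o shift x) (h *: (a + b)) - f x)) @ 0^' --> la x + m.
  by split; [apply/cvg_ex; exists (la x + m) | apply/cvg_lim].
have Hb : (fun h : R => h^-1 *: ((f \o shift x) (h *: b) - f x)) @ 0^' --> m.
  by case: dfb => + <-.
have -> : (fun h : R => h^-1 *: ((f \o shift x) (h *: (a + b)) - f x)) =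
   (fun h : R => h^-1 *: (f (x + h *: b + h *: a) - f (x + h *: b))
        + h^-1 *: ((f \o shift x) (h *: b) - f x)).
  apply/funext => h /=; rewrite -scalerDr; congr (_ *: _).
  rewrite [h *: b + x]addrC addrA subrK scalerDr; congr (f _ - _).
  by rewrite addrC [h *: a + _]addrC addrA.
apply: cvgD => //.
apply/cvgrPdist_le => e e0.
have := ca x => /cvgrPdist_le /(_ e e0) /nbhs_ballP [r /= r0 Hr].
have Na : 0 < `|a| + `|b| + 1 by rewrite ltr_wpDl // addr_ge0.
near=> h.
have h0 : h != 0 by near: h; exact: nbhs_dnbhs_neq.
have [c ch E] := @symmetric_MVT (fun t => f (x + h *: b + t *: a))
   (fun t => la (x + h *: b + t *: a)) h (fun t => is_derive_line (dfa _)).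
move: E; rewrite /= scale0r addr0 => ->.
rewrite /GRing.scale /= mulrCA mulVf // mulr1; apply: Hr.
rewrite -ball_normE /= -addrA opprD addNKr normrN.
apply: le_lt_trans (ler_normD _ _) _; rewrite !normrZ.
have : `|h| * (`|a| + `|b| + 1) < r.
  rewrite -ltr_pdivlMr //; near: h; apply: dnbhs0_lt; exact: divr_gt0.
apply: le_lt_trans; rewrite !mulrDr addrC mulr1.
rewrite -[leLHS]addr0 lerD // lerD // ler_wpM2r //.
Unshelve. all: by end_near. Qed.

Lemma is_derive_dirZ (V : normedModType R) (f : V -> R) (x a : V) (k l : R) :
  is_derive x a f l -> is_derive x (k *: a) f (k * l).
Proof.
move=> df; have [->|k0] := eqVneq k 0; first by rewrite scale0r mul0r; exact: is_derive0.
have d1 : is_derive (k * 0) 1 (fun s : R => f (x + s *: a)) l.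
  by apply: is_derive_line; rewrite mulr0 scale0r addr0.
have d2 : is_derive (0 : R) 1 (fun s : R => k * s) k.
  by apply: is_derive_eq; rewrite scaler1.
have := @is_derive1_comp R (fun s : R => f (x + s *: a)) (fun s : R => k * s) 0 l k d1 d2.
rewrite mulrC /comp /= => d3.
have E : (fun h : R => h^-1 *: ((f \o shift x) (h *: (k *: a)) - f x)) =
  (fun h : R => h^-1 *: (((fun s : R => f (x + (k * s) *: a)) \o shift 0) (h *: 1)
     - f (x + (k * 0) *: a))).
  apply/funext => h /=; rewrite mulr0 scale0r addr0 addr0 [h *: 1]mulr1.
  by rewrite scalerA [h * k]mulrC [_ + x]addrC.
by case: d3 => d3 v3; split; rewrite /derivable /derive E.
Qed.

Variable n : nat.
Implicit Types (f : 'cV[R]_n.+1 -> R) (x d : 'cV[R]_n.+1).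

Lemma col_sum_delta d : d = \sum_i d i 0 *: (delta_mx i 0 : 'cV[R]_n.+1).
Proof.
by rewrite [LHS]matrix_sum_delta; apply: eq_bigr => i _; rewrite big_ord1.
Qed.

Lemma continuous_sum_fun (T : topologicalType) (I : eqType) (r : seq I)
    (F : I -> T -> R) :
  (forall i, continuous (F i)) -> continuous (fun y => \sum_(i <- r) F i y).
Proof.
move=> cF; elim: r => [|i r IH].
  have -> : (fun y => \sum_(i <- [::]) F i y) = cst 0.
    by apply/funext => y; rewrite big_nil.
  exact: cst_continuous.
have -> : (fun y => \sum_(k <- i :: r) F k y) =
          (fun y => F i y + \sum_(j <- r) F j y).
  by apply/funext => y; rewrite big_cons.
by move=> y; exact: (cvgD (cF i y) (IH y)).
Qed.

(** The directions of the axes are added one at a time, each with a continuous partial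
    derivative. *)
Lemma is_C1_dir f d : is_C1 f ->
  forall x, is_derive x d f (\sum_i d i 0 * partial i f x).
Proof.
move=> [_ Hf].
suff H (r : seq 'I_n.+1) : forall x, is_derive x (\sum_(i <- r) d i 0 *: delta_mx i 0) f
   (\sum_(i <- r) d i 0 * partial i f x).
  by rewrite {1}[d]col_sum_delta.
elim: r => [|i r IH] x; first by rewrite !big_nil; exact: is_derive0.
rewrite !big_cons.
apply: (@is_derive_dirD _ f (fun x => d i 0 * partial i f x) _ _ _ _ _ _ (IH x)).
  by move=> y; apply: is_derive_dirZ; split => //; case: (Hf i) => H _; exact: H.
have [_ ci] := Hf i.
by move=> y; apply: (@continuousM _ _ (cst (d i 0)) (partial i f) y) => [|]; [apply: cst_continuous|apply: ci].
Qed.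

End DirectionalDerivative.

(** * Quadratic forms *)

Section BilinearForms.
Variable R : realType.

(** [bform 1%:M x x] is the square of the Euclidean norm, whereas the norm of the type of
    matrices is the maximum norm. *)
Definition bform m n (M : 'M[R]_(m, n)) (x : 'cV[R]_m) (y : 'cV[R]_n) : R :=
  (x^T *m M *m y) 0 0.

Section Rect.
Variables m n : nat.
Implicit Types (M : 'M[R]_(m, n)) (x : 'cV[R]_m) (y : 'cV[R]_n).

Lemma bformDl M x x' y : bform M (x + x') y = bform M x y + bform M x' y.
Proof. by rewrite /bform linearD /= !mulmxDl mxE. Qed.

Lemma bformDr M x y y' : bform M x (y + y') = bform M x y + bform M x y'.
Proof. by rewrite /bform mulmxDr mxE. Qed.

Lemma bformZl M a x y : bform M (a *: x) y = a * bform M x y.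
Proof. by rewrite /bform linearZ /= -!scalemxAl mxE. Qed.

Lemma bformZr M a x y : bform M x (a *: y) = a * bform M x y.
Proof. by rewrite /bform -scalemxAr mxE. Qed.

Lemma bformNl M x y : bform M (- x) y = - bform M x y.
Proof. by rewrite -scaleN1r bformZl mulN1r. Qed.

Lemma bformNr M x y : bform M x (- y) = - bform M x y.
Proof. by rewrite -scaleN1r bformZr mulN1r. Qed.

Lemma bform_tr M x y : bform M x y = bform M^T y x.
Proof.
by rewrite /bform -[in RHS](trmxK x) -!trmx_mul mulmxA [RHS]mxE.
Qed.

Lemma bformE M x y : bform M x y = \sum_i \sum_j x i 0 * M i j * y j 0.
Proof.
rewrite /bform mxE exchange_big /=; apply: eq_bigr => j _.
by rewrite mxE mulr_suml; apply: eq_bigr => i _; rewrite mxE.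
Qed.

Lemma bform0l M y : bform M 0 y = 0.
Proof. by rewrite -(scale0r 0) bformZl mul0r. Qed.

Lemma bformDm M M' x y : bform (M + M') x y = bform M x y + bform M' x y.
Proof. by rewrite /bform mulmxDr mulmxDl mxE. Qed.

Lemma bformNm M x y : bform (- M) x y = - bform M x y.
Proof. by rewrite /bform mulmxN mulNmx mxE. Qed.

End Rect.

Lemma bform_mulmxr m n p (M : 'M[R]_(m, n)) (K : 'M[R]_(n, p)) x y :
  bform M x (K *m y) = bform (M *m K) x y.
Proof. by rewrite /bform !mulmxA. Qed.

Lemma bform_mulmxl m n p (M : 'M[R]_(m, n)) (K : 'M[R]_(m, p)) x y :
  bform M (K *m x) y = bform (K^T *m M) x y.
Proof. by rewrite /bform trmx_mul !mulmxA. Qed.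

Lemma bform_line n (M : 'M[R]_n) x d t : M^T = M ->
  bform M (x + t *: d) (x + t *: d) =
  bform M x x + (2 * bform M x d) * t + bform M d d * t ^+ 2.
Proof.
move=> sM; rewrite !(bformDl, bformDr, bformZl, bformZr).
by rewrite [bform M d x]bform_tr sM; ring.
Qed.

Lemma bform1_ge0 n (x : 'cV[R]_n) : 0 <= bform 1%:M x x.
Proof.
rewrite /bform mulmx1 mxE sumr_ge0 // => i _.
by rewrite mxE -expr2 sqr_ge0.
Qed.

Lemma bform1_eq0 n (x : 'cV[R]_n) : bform 1%:M x x = 0 -> x = 0.
Proof.
rewrite /bform mulmx1 mxE => /eqP; rewrite psumr_eq0 => [/allP H|i _]; last first.
  by rewrite mxE -expr2 sqr_ge0.
apply/matrixP => i j; rewrite ord1 mxE.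
have := H i; rewrite mem_index_enum mxE -expr2 sqrf_eq0 => /(_ isT).
by move/eqP.
Qed.

(** Any form is dominated by the Euclidean one: [k] is the sum of the absolute
    values of the entries, since [2 |x_i| |x_j| <= |x_i|^2 + |x_j|^2]. *)
Lemma bform_bound n (M : 'M[R]_n) :
  exists2 k, 0 <= k & forall x, `|bform M x x| <= k * bform 1%:M x x.
Proof.
exists (\sum_i \sum_j `|M i j|).
  by apply: sumr_ge0 => i _; apply: sumr_ge0.
move=> x; have xx i : x i 0 ^+ 2 <= bform 1%:M x x.
  rewrite /bform mulmx1 mxE (bigD1 i) //= mxE -expr2 lerDl sumr_ge0 // => j _.
  by rewrite mxE -expr2 sqr_ge0.
rewrite bformE; apply: le_trans (ler_norm_sum _ _ _) _.
rewrite mulr_suml; apply: ler_sum => i _.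
apply: le_trans (ler_norm_sum _ _ _) _.
rewrite mulr_suml; apply: ler_sum => j _.
rewrite mulrAC normrM mulrC ler_wpM2l //.
have := xx i; have := xx j; rewrite normrM -!(real_normK (num_real (x _ _))).
have := sqr_ge0 (`|x i 0| - `|x j 0|); nra.
Qed.

Section Nonneg.
Variables (n : nat) (Q : 'M[R]_n).
Hypothesis psdQ : nonneg_symmetric Q.

Lemma bform_ge0 x : 0 <= bform Q x x.
Proof. by case: psdQ => _; apply. Qed.

Lemma bform_sym x y : bform Q x y = bform Q y x.
Proof. by rewrite bform_tr; case: psdQ => ->. Qed.

Lemma bform_CauchySchwarz x y : bform Q x y ^+ 2 <= bform Q x x * bform Q y y.
Proof.
have H t : 0 <= bform Q x x + (2 * bform Q x y) * t + bform Q y y * t ^+ 2.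
  by rewrite -bform_line ?bform_ge0 //; case: psdQ.
have c0 := bform_ge0 y.
set a := bform Q x x in H *; set b := bform Q x y in H *; set c := bform Q y y in H c0 *.
have [c00|cn0] := eqVneq c 0.
  have := H (- (a + 1) / (2 * b)); rewrite c00 mul0r addr0 mulr0.
  have [->|b0] := eqVneq b 0; first by rewrite expr0n.
  have -> : 2 * b * (- (a + 1) / (2 * b)) = - (a + 1) by field.
  by move=> h; exfalso; lra.
have cp : 0 < c by rewrite lt_neqAle eq_sym cn0.
have := H (- b / c).
have -> : a + 2 * b * (- b / c) + c * (- b / c) ^+ 2 = (a * c - b ^+ 2) / c by field.
by rewrite pmulr_lge0 ?invr_gt0 // subr_ge0.
Qed.

End Nonneg.

Lemma bform_delta n (M : 'M[R]_n) i j :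
  bform M (delta_mx i 0) (delta_mx j 0) = M i j.
Proof. by rewrite /bform trmx_delta -rowE -colE !mxE. Qed.

(** A factorization [Q = L L^T], kept as the list of the columns of [L]: the
    second-order part of the operator is a sum over these directions. *)
Definition dyad_sum n (S : seq 'cV[R]_n) : 'M[R]_n := \sum_(s <- S) s *m s^T.

(** Symmetric Gaussian elimination: subtracting [Q e_i (Q e_i)^T / Q_ii] keeps the
    form non-negative, by the Cauchy-Schwarz inequality, and annihilates one more
    diagonal entry; a non-negative form with zero diagonal is zero. *)
Lemma nonneg_symmetric_dyads n (Q : 'M[R]_n) :
  nonneg_symmetric Q -> exists S, Q = dyad_sum S.
Proof.
move: {2}#|_| (leqnn #|[set i | Q i i != 0%R]|%SET) => k.
elim: k Q => [|k IH] Q kQ psdQ.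
  exists [::]; rewrite /dyad_sum big_nil; apply/matrixP => i j; rewrite mxE.
  move: kQ; rewrite leqn0 cards_eq0 => /eqP/setP/(_ i); rewrite !inE => /negbFE/eqP Qi.
  have := bform_CauchySchwarz psdQ (delta_mx i 0) (delta_mx j 0).
  rewrite !bform_delta Qi mul0r => h; apply/eqP; rewrite -sqrf_eq0.
  by rewrite eq_le h sqr_ge0.
have [Q0|[ i ]] := set_0Vmem [set i | Q i i != 0%R]%SET.
  by apply: IH => //; rewrite Q0 cards0.
rewrite inE => Qi.
pose e : 'cV[R]_n := delta_mx i 0; pose c := Q i i.
have c0 : 0 < c.
  by rewrite lt_neqAle eq_sym Qi /c -(bform_delta Q i i) bform_ge0.
pose s := (Num.sqrt c)^-1 *: (Q *m e).
have sE x : (x^T *m s) 0 0 = (Num.sqrt c)^-1 * bform Q x e.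
  by rewrite /s -scalemxAr mxE mulmxA.
have [sQ _] := psdQ.
pose Q' := Q - s *m s^T.
have bQ' x y : bform Q' x y = bform Q x y - bform Q x e * bform Q y e / c.
  rewrite /Q' bformDm bformNm; congr (_ - _).
  have -> : bform (s *m s^T) x y = (x^T *m s) 0 0 * (y^T *m s) 0 0.
    rewrite /bform mulmxA -mulmxA mxE big_ord1; congr (_ * _).
    by rewrite -[in RHS](trmxK s) -trmx_mul [RHS]mxE.
  rewrite !sE; have /eqP := sqr_sqrtr (ltW c0).
  have : Num.sqrt c != 0 by rewrite sqrtr_eq0 -ltNge.
  by set r := Num.sqrt c => r0 /eqP <-; field.
have psdQ' : nonneg_symmetric Q'.
  split; first by rewrite /Q' linearB /= trmx_mul trmxK sQ.
  move=> x; have -> : (x^T *m Q' *m x) 0 0 = bform Q' x x by [].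
  rewrite bQ' subr_ge0 ler_pdivrMr // -expr2.
  by have := bform_CauchySchwarz psdQ x e; rewrite bform_delta.
have [|S QS] := IH Q' _ psdQ'.
  rewrite -ltnS; apply: leq_trans _ kQ; apply: proper_card; apply/properP; split.
    apply/fintype.subsetP => j; rewrite !inE -(bform_delta Q' j j) bQ'; apply: contraNN => /eqP Qj.
    rewrite bform_delta Qj sub0r oppr_eq0.
    have := bform_CauchySchwarz psdQ (delta_mx j 0) e.
    rewrite !bform_delta Qj mul0r => h.
    have /eqP : Q j i ^+ 2 = 0 by apply/eqP; rewrite eq_le h sqr_ge0.
    by rewrite sqrf_eq0 => /eqP ->; rewrite mul0r mul0r.
  exists i; rewrite inE // -(bform_delta Q' i i) bQ' !bform_delta -/c.
  by rewrite mulfK ?subrr ?eqxx // gt_eqF.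
exists (s :: S); rewrite /dyad_sum big_cons -/(dyad_sum S) -QS /Q'.
by rewrite addrC subrK.
Qed.

Section DyadSums.
Variables (n : nat) (S : seq 'cV[R]_n).

Lemma sum_bform_dyads m k (M : 'M[R]_(m, n)) (K : 'M[R]_(k, n)) x y :
  \sum_(s <- S) bform M x s * bform K y s = bform (M *m dyad_sum S *m K^T) x y.
Proof.
rewrite /dyad_sum mulmx_sumr mulmx_suml /bform mulmx_sumr mulmx_suml summxE.
apply: eq_bigr => s _; rewrite [X in _ * X]bform_tr /bform.
have -> : x^T *m (M *m (s *m s^T) *m K^T) *m y = (x^T *m M *m s) *m (s^T *m K^T *m y).
  by rewrite !mulmxA.
by rewrite [RHS]mxE big_ord1.
Qed.

Lemma sum_bform_diag (M : 'M[R]_n) :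
  \sum_(s <- S) bform M s s = \tr (dyad_sum S *m M).
Proof.
rewrite /dyad_sum mulmx_suml linear_sum /=; apply: eq_bigr => s _.
by rewrite -mulmxA mxtrace_mulC /mxtrace big_ord1.
Qed.

End DyadSums.
End BilinearForms.

(** * Second-order tests along lines *)

Section SecondOrderJets.
Variable R : realType.
Implicit Types (f g : R -> R).

(** The first derivative is required everywhere but the second one only at 0, which is
    enough for the second-derivative test. *)
Definition jet2 f (p q : R) := exists f1 : R -> R,
  [/\ forall t : R, is_derive t 1 f (f1 t), f1 0 = p & is_derive (0 : R) 1 f1 q].

Lemma jet2_eq f p q p' q' : jet2 f p q -> p = p' -> q = q' -> jet2 f p' q'.
Proof. by move=> + <- <-. Qed.

Lemma jet2D f g p q p' q' :
  jet2 f p q -> jet2 g p' q' -> jet2 (fun t => f t + g t) (p + p') (q + q').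
Proof.
move=> [f1 [df f10 df1]] [g1 [dg g10 dg1]]; exists (fun t => f1 t + g1 t).
split; [move=> t; exact: is_deriveD|by rewrite f10 g10|exact: is_deriveD].
Qed.

Lemma jet2M f g p q p' q' : jet2 f p q -> jet2 g p' q' ->
  jet2 (fun t => f t * g t) (f 0 * p' + g 0 * p) (f 0 * q' + 2 * (p * p') + g 0 * q).
Proof.
move=> [f1 [df f10 df1]] [g1 [dg g10 dg1]].
exists (fun t => f t * g1 t + g t * f1 t); split.
- by move=> t; exact: is_deriveM.
- by rewrite f10 g10.
- have d1 : is_derive (0 : R) 1 (fun t => f t * g1 t) (f 0 * q' + g1 0 * f1 0).
    exact: is_deriveM.
  have d2 : is_derive (0 : R) 1 (fun t => g t * f1 t) (g 0 * q + f1 0 * g1 0).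
    exact: is_deriveM.
  apply: is_derive_eq (is_deriveD d1 d2) _.
  by rewrite f10 g10; ring.
Qed.

Lemma jet2_cst c : jet2 (fun=> c) 0 0.
Proof.
exists (fun=> 0); split => // [t|]; exact: is_derive_cst.
Qed.

Lemma is_derive_affine (a b t : R) : is_derive t 1 (fun s => a + b * s) b.
Proof.
have d := is_deriveD (is_derive_cst a t 1) (is_deriveZ b (is_derive_id t 1)).
by apply: is_derive_eq d _; rewrite add0r [_ *: _]mulr1.
Qed.

Lemma is_derive_quad (a b c t : R) :
  is_derive t 1 (fun s => a + b * s + c * s ^+ 2) (b + 2 * c * t).
Proof.
have d := is_deriveD (is_derive_affine a b t)
  (is_deriveZ c (is_deriveM (is_derive_id t 1) (is_derive_id t 1))).
apply: is_derive_eq d _; rewrite /GRing.scale /=; ring.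
Qed.

Lemma jet2_quad a b c : jet2 (fun t => a + b * t + c * t ^+ 2) b (2 * c).
Proof.
exists (fun t => b + 2 * c * t); split.
- by move=> t; exact: is_derive_quad.
- by rewrite mulr0 addr0.
- exact: is_derive_affine.
Qed.

Lemma jet2_comp (h h1 : R -> R) (h2 : R) f p q : jet2 f p q ->
  (forall t : R, is_derive (f t) 1 h (h1 (f t))) -> is_derive (f 0) 1 h1 h2 ->
  jet2 (fun t => h (f t)) (h1 (f 0) * p) (h2 * p ^+ 2 + h1 (f 0) * q).
Proof.
move=> [f1 [df f10 df1]] dh dh1; exists (fun t => h1 (f t) * f1 t); split.
- by move=> t; exact: is_derive1_comp.
- by rewrite f10.
- have d1 : is_derive (0 : R) 1 (fun t => h1 (f t)) (h2 * f1 0).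
    exact: is_derive1_comp.
  have d2 : is_derive (0 : R) 1 (fun t => h1 (f t) * f1 t) (h1 (f 0) * q + f1 0 * (h2 * f1 0)).
    exact: is_deriveM.
  by apply: is_derive_eq d2 _; rewrite f10; ring.
Qed.

(** Were the second derivative negative, the first one would be negative on the right
    of 0 and the function would decrease there. *)
Lemma jet2_min f p q : jet2 f p q -> (forall t, f 0 <= f t) -> p = 0 /\ 0 <= q.
Proof.
move=> [f1 [df f10 df1]] fmin.
have d0 : is_derive (0 : R) 1 f 0.
  apply: (@derive1_at_min R f (-1) 1 0) => //.
  by rewrite in_itv /=; apply/andP; split; lra.
have p0 : p = 0.
  by rewrite -f10 -(@derive_val _ _ _ _ _ _ _ (df 0)) (@derive_val _ _ _ _ _ _ _ d0).
split=> //; rewrite leNgt; apply/negP => q0.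
have : (fun k : R => k^-1 *: ((f1 \o shift 0) (k *: 1) - f1 0)) @ 0^' --> q.
  by case: df1 => + <-.
move=> /cvgrPdist_lt /(_ (- q)); rewrite oppr_gt0 => /(_ q0).
move=> [r /= r0 Hr].
have neg c : 0 < c -> c < r -> f1 c < 0.
  move=> c0 cr; have := Hr c; rewrite /= sub0r normrN gtr0_norm // => /(_ cr).
  rewrite gt_eqF // => /(_ isT); rewrite f10 p0 subr0 addr0 [c *: 1]mulr1 ltr_norml.
  rewrite /GRing.scale /= => /andP[h _].
  have : c^-1 * f1 c < 0 by lra.
  by rewrite pmulr_rlt0 ?invr_gt0.
have cf : continuous f.
  by move=> t; apply/differentiable_continuous/derivable1_diffP; case: (df t).
have r2 : 0 < r / 2 by rewrite divr_gt0.
have [|c /[!in_itv] /= /andP[c0 cr] E] := @MVT R f f1 0 (r / 2) r2 (fun x _ => df x).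
  exact: continuous_subspaceT.
have := neg c c0; have -> : c < r by lra.
have := fmin (r / 2); move=> h /(_ isT) h'.
have : f1 c * (r / 2 - 0) < 0 by rewrite pmulr_llt0 // subr0.
by rewrite -E; lra.
Qed.

Variable n : nat.
Implicit Types (u : 'cV[R]_n.+1 -> R) (x d : 'cV[R]_n.+1).

Lemma jet2_C2 u x d : is_C2 u ->
  jet2 (fun t => u (x + t *: d)) (inner d (gradient u x)) (bform (hessian u x)^T d d).
Proof.
move=> [C1u C2u].
exists (fun t => \sum_i d i 0 * partial i u (x + t *: d)); split.
- by move=> t; apply: is_derive_line; exact: is_C1_dir.
- by apply: eq_bigr => i _; rewrite scale0r addr0 !mxE.
- suff H : is_derive (0 : R) 1 (\sum_i (fun t : R => d i 0 * partial i u (x + t *: d)))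
      (\sum_i d i 0 * \sum_j d j 0 * partial j (partial i u) x).
    have -> : (fun t : R => \sum_i d i 0 * partial i u (x + t *: d)) =
              \sum_i (fun t : R => d i 0 * partial i u (x + t *: d)).
      by apply/funext => t; rewrite fct_sumE.
    apply: is_derive_eq H _; rewrite bformE; apply: eq_bigr => i _.
    by rewrite mulr_sumr; apply: eq_bigr => j _; rewrite !mxE; ring.
  apply: is_derive_sum => i.
  apply: (@is_deriveZ _ _ _ (fun t : R => partial i u (x + t *: d))).
  apply: is_derive_line; rewrite scale0r addr0; exact: is_C1_dir.
Qed.

Lemma OU_dyads (S : seq 'cV[R]_n.+1) (B : 'M[R]_n.+1) u x :
  OU_operator (dyad_sum S) B u x =
  2^-1 * (\sum_(s <- S) bform (hessian u x)^T s s) + inner (B *m x) (gradient u x).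
Proof.
rewrite /OU_operator -sum_bform_diag; congr (_ * _ + _).
by apply: eq_bigr => s _; rewrite [RHS]bform_tr trmxK.
Qed.

(** The second-order test for touching from below: at a minimum of [u - phi] the
    generator of [u] dominates that of [phi], and the generator of [phi] is read
    off from its restrictions to lines, along the dyads of [Q] and along the drift. *)
Lemma OU_touching (S : seq 'cV[R]_n.+1) (B : 'M[R]_n.+1) u (phi : 'cV[R]_n.+1 -> R)
    x (p q : 'cV[R]_n.+1 -> R) :
  is_C2 u -> (forall y, u x - phi x <= u y - phi y) ->
  (forall d, jet2 (fun t => phi (x + t *: d)) (p d) (q d)) ->
  2^-1 * (\sum_(s <- S) q s) + p (B *m x) <= OU_operator (dyad_sum S) B u x.
Proof.
move=> C2u umin jphi.
have H d : inner d (gradient u x) = p d /\ q d <= bform (hessian u x)^T d d.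
  have jN : jet2 (fun t => -1 * phi (x + t *: d)) (- p d) (- q d).
    apply: jet2_eq (jet2M (jet2_cst (-1)) (jphi d)) _ _; ring.
  have := jet2_min (jet2D (jet2_C2 x d C2u) jN).
  case => [t|/eqP + h2].
    by rewrite scale0r addr0 !mulN1r; apply: umin.
  by rewrite subr_eq0 => /eqP ->; split => //; rewrite -subr_ge0.
rewrite OU_dyads lerD //; last by case: (H (B *m x)) => ->.
by rewrite ler_pM2l ?invr_gt0 // ler_sum // => s _; case: (H s).
Qed.

End SecondOrderJets.

(** * Compactness, and minima forced by Lyapunov functions *)

Section Compactness.
Variable R : realType.

Lemma continuous_bform (T : topologicalType) n (M : 'M[R]_n) (f g : T -> 'cV[R]_n) :
  (forall i, continuous (fun t => f t i 0)) ->
  (forall i, continuous (fun t => g t i 0)) ->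
  continuous (fun t => bform M (f t) (g t)).
Proof.
move=> cf cg.
have -> : (fun t => bform M (f t) (g t)) =
          (fun t => \sum_i \sum_j f t i 0 * M i j * g t j 0).
  by apply/funext => t; rewrite bformE.
apply: continuous_sum_fun => i; apply: continuous_sum_fun => j t.
apply: (@continuousM _ _ (fun t => f t i 0 * M i j) (fun t => g t j 0)); last exact: cg.
apply: (@continuousM _ _ (fun t => f t i 0) (cst (M i j))); first exact: cf.
exact: cst_continuous.
Qed.

Lemma continuous_qform n (M : 'M[R]_n) : continuous (fun x => bform M x x).
Proof. by apply: continuous_bform => i; exact: coord_continuous. Qed.

Lemma trmx_continuous m n : continuous (@trmx R m n).
Proof.
move=> x A /nbhs_ballP [e e0 eA]; apply/nbhs_ballP; exists e => //= y [_ H].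
by apply: eA; split => // i j; rewrite !mxE; exact: H.
Qed.

Lemma compact_ball n (K : R) : compact [set x : 'cV[R]_n | bform 1%:M x x <= K].
Proof.
pose M := `|K| + 1.
have c1 : compact [set v : 'rV[R]_n | forall i, v ord0 i \in `[- M, M]].
  apply: (@rV_compact _ _ (fun=> `[- M, M]%classic)).
  by move=> _; exact: segment_compact.
have c2 := continuous_compact (continuous_subspaceT (@trmx_continuous 1 n)) c1.
apply: subclosed_compact _ c2 _.
  apply: (@preimage_closed _ _ (fun x : 'cV[R]_n => bform 1%:M x x) [set y | y <= K]).
    by move=> y _; exact: continuous_qform.
  exact: closed_le.
move=> x /= xK; exists x^T; last by rewrite trmxK.
move=> i /=; rewrite mxE in_itv /= -ler_norml.
have : x i ord0 ^+ 2 <= K.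
  apply: le_trans _ xK.
  rewrite /bform mulmx1 mxE (bigD1 i) //= mxE -expr2 lerDl sumr_ge0 // => j _.
  by rewrite mxE -expr2 sqr_ge0.
have := ler_norm K; have := normr_ge0 (x i ord0).
rewrite -(real_normK (num_real (x i ord0))) /M.
set z := `|x i ord0|; set k := `|K| => z0 Kk zK.
rewrite leNgt; apply/negP => h; nra.
Qed.

Lemma coercive_min n (f : 'cV[R]_n -> R) (K : R) : continuous f ->
  (forall x, f x <= f 0 -> bform 1%:M x x <= K) -> exists x, forall y, f x <= f y.
Proof.
move=> cf fK.
have [||x xK xmin] := @compact_EVT_min _ R f _ _ (@compact_ball n K).
- by exists 0 => /=; exact: fK.
- exact: continuous_subspaceT.
exists x => y; have [/fK yK|/ltW fy] := leP (f y) (f 0).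
  by apply: xmin; rewrite inE.
by apply: le_trans fy; apply: xmin; rewrite inE /=; exact: fK.
Qed.

End Compactness.

Section Lyapunov.
Variables (R : realType) (n : nat) (S : seq 'cV[R]_n.+1) (B : 'M[R]_n.+1).
Local Notation Q := (dyad_sum S).

(** The operator applied to a function whose restriction to the line through [x] of
    direction [d] has the derivatives [p x d] and [q x d]. *)
Definition OU_lines (p q : 'cV[R]_n.+1 -> 'cV[R]_n.+1 -> R) (x : 'cV[R]_n.+1) : R :=
  2^-1 * (\sum_(s <- S) q x s) + p x (B *m x).

(** Second derivatives are only asked for along lines, in the form in which the touching
    test consumes them. *)
Record lyapunov (W : 'cV[R]_n.+1 -> R) : Prop := Lyapunov {
  lyapunov_cont : continuous W;
  lyapunov_lb : exists w0, forall x, w0 <= W x;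
  lyapunov_coercive : forall M, exists K, forall x, W x <= M -> bform 1%:M x x <= K;
  lyapunov_drift : exists p q : 'cV[R]_n.+1 -> 'cV[R]_n.+1 -> R,
    (forall x d, jet2 (fun t => W (x + t *: d)) (p x d) (q x d)) /\
    exists2 K, 0 <= K & forall x, 0 <= OU_lines p q x -> bform 1%:M x x <= K }.

(** A minimum point of [v + e W] lies in a ball that does not depend on [e], because
    there the drift of [W] is non-negative; then [e] tends to 0. *)
Lemma lyapunov_min W (v : 'cV[R]_n.+1 -> R) : lyapunov W -> is_C2 v ->
  (forall x, 0 <= v x) -> (forall x, OU_operator Q B v x <= 0) ->
  exists x, forall y, v x <= v y.
Proof.
move=> [cW [w0 Ww0] coW [p [q [jW [K K0 WK]]]]] C2v v0 sv.
have cv : continuous v by case: C2v => -[].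
have [||x xK xmin] := @compact_EVT_min _ R v _ _ (@compact_ball R n.+1 K).
- by exists 0 => /=; rewrite bform0l.
- exact: continuous_subspaceT.
exists x => y.
suff H e : 0 < e -> v x <= v y + e * (W y - w0).
  rewrite leNgt; apply/negP => vyx.
  have Wy := Ww0 y.
  have d0 : 0 < W y - w0 + 1 by lra.
  have e0 : 0 < (v x - v y) / (W y - w0 + 1) by rewrite divr_gt0 // subr_gt0.
  have := H _ e0; rewrite mulrAC -lerBlDl.
  rewrite ler_pdivlMr //.
  have : 0 < v x - v y by lra.
  by nra.
move=> e0.
pose f z := v z + e * W z.
have cf : continuous f.
  move=> z; apply: (@continuousD _ _ _ v (fun z => e * W z)); first exact: cv.
  by apply: (@continuousM _ _ (cst e) W); [exact: cst_continuous | exact: cW].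
have [K' HK'] := coW (f 0 / e).
have [|xe xemin] := coercive_min (K := K') cf.
  move=> z fz; apply: HK'; rewrite ler_pdivlMr // mulrC; apply: le_trans fz.
  by rewrite /f lerDr.
have xeK : bform 1%:M xe xe <= K.
  apply: WK.
  have touch z : v xe - (- e * W xe) <= v z - (- e * W z).
    by have := xemin z; rewrite /f; lra.
  have jphi d : jet2 (fun t => - e * W (xe + t *: d)) (- e * p xe d) (- e * q xe d).
    by apply: jet2_eq (jet2M (jet2_cst (- e)) (jW xe d)) _ _; ring.
  have := le_trans (OU_touching S B C2v touch jphi) (sv xe).
  rewrite -mulr_sumr /OU_lines; set T := \sum_(s <- S) _ => h.
  have : 0 <= e * (2^-1 * T + p xe (B *m xe)) by lra.
  by rewrite pmulr_rge0.
have := xmin xe; rewrite inE => /(_ xeK) h.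
have := xemin y; have := Ww0 xe; rewrite /f; nra.
Qed.

End Lyapunov.

(** * The drift of the Lyapunov function *)

Section LyapunovFunction.
Variable R : realType.

(** Forms adapted to a drift with a stable part, seen by [H], and a neutral part,
    seen by [G]. The form [C] compensates the anisotropy of the noise in the neutral
    plane: rotation averages the noise to an isotropic one, and [C] is the
    corresponding corrector. *)
Record OU_forms n (Q B G C H : 'M[R]_n) (k delta : R) : Prop := OUForms {
  neutral_form : nonneg_symmetric G;
  corrector_sym : C^T = C;
  stable_form : nonneg_symmetric H;
  forms_k_ge0 : 0 <= k;
  forms_delta_gt0 : 0 < delta;
  neutral_drift : forall x, bform G x (B *m x) = 0;
  neutral_noise : forall x, \tr (Q *m G) * bform G x x + 2 * bform C x (B *m x)
                    <= 2 * bform (G *m Q *m G) x x;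
  corrector_bound : forall x, `|bform C x x| <= k * bform G x x;
  corrector_noise : forall x, `|bform (C *m Q *m G) x x| <= k * bform G x x;
  stable_drift : forall x, bform H x (B *m x) <= - delta * bform H x x;
  forms_coercive : forall x, bform 1%:M x x <= k * (bform G x x + bform H x x);
  neutral_nondeg : 0 < \tr (Q *m G) \/ forall x, bform G x x = 0 }.

(** The hypothesis says that the operator is non-negative on the Lyapunov function at a
    point where [r = a + rho]; its coefficients are derivatives of [ln r - A / r], of the
    profile [r^-2 + 2 A r^-3] of the corrector and of [r^-2]. That profile is minus the
    second derivative of [ln r - A / r], so that the drift [kappa] of the corrector replaces
    [theta] by the isotropic value [s rho / 2]; the terms of order [r] then cancel after
    multiplication by [r^2], and [- s (A - a)] is left of the main part as [r] grows. The
    other contributions of the corrector are bounded, and for large [a] the products of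
    [h] with the noise are smaller than its decay [delta h]. *)
Lemma lyapunov_drift_estimate
    (s k delta a A r rho theta kappa c chi tC h omega tH eta : R) :
  0 <= k -> 0 < delta -> 0 <= s -> 1 <= a -> 0 <= A -> 0 <= rho -> 0 <= h ->
  r = a + rho -> 0 <= theta -> theta <= s * rho ->
  s * rho + 2 * kappa <= 2 * theta -> `|c| <= k * rho -> `|chi| <= k * rho ->
  tC <= k -> tH <= k -> `|omega| <= k * (h + rho) -> eta <= - delta * h ->
  12 * s + 8 * k <= delta * a ->
  let i := r^-1 in
  0 <= - (i ^+ 2 + 2 * A * i ^+ 3) * (2 * theta - 2 * kappa) + (i + A * i ^+ 2) * s
    + c * (2 * (6 * i ^+ 4 + 24 * A * i ^+ 5) * theta - (2 * i ^+ 3 + 6 * A * i ^+ 4) * s)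
    - 4 * (2 * i ^+ 3 + 6 * A * i ^+ 4) * chi + (i ^+ 2 + 2 * A * i ^+ 3) * tC
    + h * (12 * i ^+ 4 * theta - 2 * i ^+ 3 * s) - 8 * i ^+ 3 * omega + i ^+ 2 * tH
    + 2 * i ^+ 2 * eta ->
  delta * h <= - s * (A - a) + (14 * k * s + 18 * k)
    + (2 * s * a + 54 * k * s + 26 * k) * A * i.
Proof.
move=> k0 d0 s0 a1 A0 rho0 h0 rE th0 th1 H1 cb chib tCb tHb omb etab ab i.
have r0 : 0 < r by lra.
have i0 : 0 < i by rewrite invr_gt0.
have ri : r * i = 1 by rewrite mulfV // gt_eqF.
have i1 : i <= 1 by rewrite invf_le1 //; lra.
clearbody i.
have [w [wE w0 w1]] : exists w, [/\ rho * i = w, 0 <= w & w <= 1].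
  exists (rho * i); split => //; first by rewrite mulr_ge0 // ltW.
  by rewrite -ri ler_pM2r //; lra.
have Ai0 : 0 <= A * i by rewrite mulr_ge0 // ltW.
pose E := - (1 + 2 * A * i) * (2 * theta - 2 * kappa) + (r + A) * s
    + c * (2 * (6 * i ^+ 2 + 24 * A * i ^+ 3) * theta)
    + c * (- (2 * i + 6 * A * i ^+ 2) * s)
    - 4 * (2 * i + 6 * A * i ^+ 2) * chi + (1 + 2 * A * i) * tC
    + h * (12 * i ^+ 2 * theta - 2 * i * s) - 8 * i * omega + tH + 2 * eta.
set LW := (X in 0 <= X -> _).
have -> : LW = i ^+ 2 * E.
  have e : i = i ^+ 2 * r by rewrite expr2 -mulrA [i * r]mulrC ri mulr1.
  have -> : LW = i ^+ 2 * E + s * (i - i ^+ 2 * r) by rewrite /LW /E; ring.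
  by rewrite -e subrr mulr0 addr0.
rewrite pmulr_rge0 ?exprn_gt0 // => E0.
have T1 : - (1 + 2 * A * i) * (2 * theta - 2 * kappa) + (r + A) * s
     <= - s * (A - a) + 2 * s * a * (A * i).
  have h1 : 0 <= (1 + 2 * (A * i)) * (2 * theta - 2 * kappa - s * rho).
    by apply: mulr_ge0; lra.
  have h2 : s * A * (r * i) = s * A by rewrite ri mulr1.
  have rhoE : rho = r - a by lra.
  move: h1; rewrite rhoE; move: h2.
  set z := r * i in ri *.
  have e1 : (1 + 2 * (A * i)) * (2 * theta - 2 * kappa - s * (r - a)) =
    (1 + 2 * A * i) * (2 * theta - 2 * kappa) - s * r + s * a - 2 * (s * A * z) + 2 * s * a * (A * i).
    by rewrite /z; ring.
  by rewrite e1 => ->; lra.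
have cX X : 0 <= X -> c * X <= k * rho * X.
  move=> X0; apply: ler_wpM2r => //; apply: le_trans cb; exact: ler_norm.
have cX' X : 0 <= X -> c * (- X) <= k * rho * X.
  move=> X0; rewrite mulrN -mulNr; apply: ler_wpM2r => //.
  by apply: le_trans cb; rewrite -normrN; exact: ler_norm.
have w2 : w ^+ 2 <= 1 by rewrite expr_le1.
have ks0 : 0 <= k * s by rewrite mulr_ge0.
have T2 : c * (2 * (6 * i ^+ 2 + 24 * A * i ^+ 3) * theta) <= k * s * (12 + 48 * (A * i)).
  have i2 : 0 <= 6 * i ^+ 2 + 24 * A * i ^+ 3.
    have -> : 6 * i ^+ 2 + 24 * A * i ^+ 3 = i ^+ 2 * (6 + 24 * (A * i)) by ring.
    by apply: mulr_ge0; [exact: sqr_ge0 | lra].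
  apply: (le_trans (cX _ _)); first by apply: mulr_ge0 => //; apply: mulr_ge0.
  have : k * rho * (2 * (6 * i ^+ 2 + 24 * A * i ^+ 3) * theta) <=
         k * rho * (2 * (6 * i ^+ 2 + 24 * A * i ^+ 3) * (s * rho)).
    by apply: ler_wpM2l; [exact: mulr_ge0 | apply: ler_wpM2l => //; apply: mulr_ge0].
  move=> h1; apply: (le_trans h1).
  have -> : k * rho * (2 * (6 * i ^+ 2 + 24 * A * i ^+ 3) * (s * rho)) =
            k * s * (12 + 48 * (A * i)) * (rho * i) ^+ 2 by ring.
  rewrite wE -[leRHS]mulr1; apply: ler_wpM2l => //.
  by apply: mulr_ge0 => //; lra.
have T3 : c * (- (2 * i + 6 * A * i ^+ 2) * s) <= k * s * (2 + 6 * (A * i)).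
  rewrite mulNr.
  have e : (2 * i + 6 * A * i ^+ 2) * s = i * ((2 + 6 * (A * i)) * s) by ring.
  apply: (le_trans (cX' _ _)).
    by rewrite e; apply: mulr_ge0; [exact: ltW | apply: mulr_ge0 => //; lra].
  have -> : k * rho * ((2 * i + 6 * A * i ^+ 2) * s) = k * s * (2 + 6 * (A * i)) * (rho * i) by ring.
  rewrite wE -[leRHS]mulr1; apply: ler_wpM2l => //.
  by apply: mulr_ge0 => //; lra.
have T4 : - 4 * (2 * i + 6 * A * i ^+ 2) * chi <= k * (8 + 24 * (A * i)).
  have chi1 : - chi <= k * rho by apply: le_trans chib; rewrite -normrN; exact: ler_norm.
  have -> : - 4 * (2 * i + 6 * A * i ^+ 2) * chi = i * (8 + 24 * (A * i)) * (- chi) by ring.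
  have : i * (8 + 24 * (A * i)) * (- chi) <= i * (8 + 24 * (A * i)) * (k * rho).
    by apply: ler_wpM2l => //; apply: mulr_ge0; [exact: ltW | lra].
  move=> h1; apply: (le_trans h1).
  have -> : i * (8 + 24 * (A * i)) * (k * rho) = k * (8 + 24 * (A * i)) * (rho * i) by ring.
  rewrite wE -[leRHS]mulr1; apply: ler_wpM2l => //.
  by apply: mulr_ge0 => //; lra.
have T5 : (1 + 2 * A * i) * tC <= k * (1 + 2 * (A * i)).
  by rewrite mulrC -[2 * A * i]mulrA; apply: ler_wpM2r => //; lra.
have ih0 : 0 <= i * h by apply: mulr_ge0 => //; exact: ltW.
have T6 : h * (12 * i ^+ 2 * theta - 2 * i * s) <= 12 * s * (i * h).
  have h1 : h * (12 * i ^+ 2) * theta <= h * (12 * i ^+ 2) * (s * rho).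
    by apply: ler_wpM2l => //; apply: mulr_ge0 => //; apply: mulr_ge0 => //; exact: sqr_ge0.
  have h2 : h * (12 * i ^+ 2) * (s * rho) = 12 * s * (i * h) * w by rewrite -wE; ring.
  have h3 : 12 * s * (i * h) * w <= 12 * s * (i * h).
    by rewrite -[leRHS]mulr1; apply: ler_wpM2l => //; apply: mulr_ge0 => //; lra.
  have h4 : 0 <= s * (i * h) by apply: mulr_ge0.
  have -> : h * (12 * i ^+ 2 * theta - 2 * i * s) =
    h * (12 * i ^+ 2) * theta - 2 * (s * (i * h)) by ring.
  by lra.
have T7 : - 8 * i * omega <= 8 * k * (i * h) + 8 * k.
  have om1 : - omega <= k * (h + rho) by apply: le_trans omb; rewrite -normrN; exact: ler_norm.
  have -> : - 8 * i * omega = 8 * i * (- omega) by ring.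
  have h1 : 8 * i * (- omega) <= 8 * i * (k * (h + rho)) by apply: ler_wpM2l => //; lra.
  have h2 : 8 * i * (k * (h + rho)) = 8 * k * (i * h) + 8 * (k * w) by rewrite -wE; ring.
  have : k * w <= k by rewrite -[leRHS]mulr1; apply: ler_wpM2l.
  by lra.
have T8 : (12 * s + 8 * k) * (i * h) <= delta * h.
  have ai : a * i <= 1 by rewrite -ri ler_pM2r //; lra.
  have h1 : (12 * s + 8 * k) * (i * h) <= delta * a * (i * h) by apply: ler_wpM2r.
  have h2 : delta * a * (i * h) = delta * h * (a * i) by ring.
  have h3 : delta * h * (a * i) <= delta * h.
    by rewrite -[leRHS]mulr1; apply: ler_wpM2l => //; apply: mulr_ge0 => //; exact: ltW.
  by lra.
move: E0; rewrite /E.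
have -> : - s * (A - a) + (14 * k * s + 18 * k) + (2 * s * a + 54 * k * s + 26 * k) * A * i
  = - s * (A - a) + 2 * s * a * (A * i) + k * s * (12 + 48 * (A * i)) + k * s * (2 + 6 * (A * i))
    + k * (8 + 24 * (A * i)) + k * (1 + 2 * (A * i)) + 8 * k + k by ring.
by lra.
Qed.

End LyapunovFunction.

Section LyapunovConstruction.
Variable R : realType.

Lemma is_derive_invX (k : nat) (c r : R) : r != 0 ->
  is_derive r 1 (fun y => c * y^-1 ^+ k.+1) (- (c * k.+1%:R) * r^-1 ^+ k.+2).
Proof.
move=> r0.
have d := is_deriveZ c (is_deriveX k.+1 (is_deriveV r0 (is_derive_id r 1))).
move: d; rewrite exprfctE => d.
apply: is_derive_eq d _; rewrite /GRing.scale /= !exprVn exprSr (exprSr r k.+1) (exprSr r k).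
have : r ^+ k != 0 by rewrite expf_neq0.
by set z := r ^+ k => z0; field; rewrite z0 r0.
Qed.

Section Profiles.
Variable A : R.
Definition lyap_main (r : R) := ln r - A * r^-1.
Definition lyap_corr (r : R) := r^-1 ^+ 2 + 2 * A * r^-1 ^+ 3.

Lemma is_derive_lyap_main (r : R) : 0 < r ->
  is_derive r 1 lyap_main (r^-1 + A * r^-1 ^+ 2).
Proof.
move=> r0; have rn0 : r != 0 by rewrite gt_eqF.
have d := is_deriveD (is_derive1_ln r0) (@is_derive_invX 0 (- A) r rn0).
have -> : lyap_main = (@ln R + (fun y => - A * y^-1 ^+ 1))%R.
  by apply/funext => y; rewrite addrfctE /lyap_main expr1 mulNr.
by apply: is_derive_eq d _; ring.
Qed.

Lemma is_derive_lyap_main1 (r : R) : 0 < r ->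
  is_derive r 1 (fun r => r^-1 + A * r^-1 ^+ 2) (- lyap_corr r).
Proof.
move=> r0; have rn0 : r != 0 by rewrite gt_eqF.
have d := is_deriveD (@is_derive_invX 0 1 r rn0) (@is_derive_invX 1 A r rn0).
have -> : (fun r => r^-1 + A * r^-1 ^+ 2) =
  ((fun y : R => 1 * y^-1 ^+ 1) + (fun y => A * y^-1 ^+ 2))%R.
  by apply/funext => y; rewrite !fctE expr1 mul1r.
by apply: is_derive_eq d _; rewrite /lyap_corr; ring.
Qed.

Lemma is_derive_lyap_corr (r : R) : 0 < r ->
  is_derive r 1 lyap_corr (- (2 * r^-1 ^+ 3 + 6 * A * r^-1 ^+ 4)).
Proof.
move=> r0; have rn0 : r != 0 by rewrite gt_eqF.
have d := is_deriveD (@is_derive_invX 1 1 r rn0) (@is_derive_invX 2 (2 * A) r rn0).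
have -> : lyap_corr =
  ((fun y : R => 1 * y^-1 ^+ 2) + (fun y => 2 * A * y^-1 ^+ 3))%R.
  by apply/funext => y; rewrite !fctE mul1r.
by apply: is_derive_eq d _; ring.
Qed.

Lemma is_derive_lyap_corr1 (r : R) : 0 < r ->
  is_derive r 1 (fun r => - (2 * r^-1 ^+ 3 + 6 * A * r^-1 ^+ 4))
    (6 * r^-1 ^+ 4 + 24 * A * r^-1 ^+ 5).
Proof.
move=> r0; have rn0 : r != 0 by rewrite gt_eqF.
have d := is_deriveD (@is_derive_invX 2 (-2) r rn0) (@is_derive_invX 3 (- 6 * A) r rn0).
have -> : (fun r => - (2 * r^-1 ^+ 3 + 6 * A * r^-1 ^+ 4)) =
  ((fun y : R => -2 * y^-1 ^+ 3) + (fun y => - 6 * A * y^-1 ^+ 4))%R.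
  by apply/funext => y; rewrite !fctE; ring.
by apply: is_derive_eq d _; ring.
Qed.

End Profiles.

Lemma is_derive_invsq (r : R) : 0 < r ->
  is_derive r 1 (fun r => r^-1 ^+ 2) (- 2 * r^-1 ^+ 3).
Proof.
move=> r0; have rn0 : r != 0 by rewrite gt_eqF.
have d := @is_derive_invX 1 1 r rn0.
have -> : (fun r => r^-1 ^+ 2) = (fun y : R => 1 * y^-1 ^+ 2).
  by apply/funext => y; rewrite mul1r.
by apply: is_derive_eq d _; ring.
Qed.

Lemma is_derive_invsq1 (r : R) : 0 < r ->
  is_derive r 1 (fun r => - 2 * r^-1 ^+ 3) (6 * r^-1 ^+ 4).
Proof.
move=> r0; have rn0 : r != 0 by rewrite gt_eqF.
by apply: is_derive_eq (@is_derive_invX 2 (-2) r rn0) _; ring.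
Qed.

Variables (n : nat) (S : seq 'cV[R]_n.+1) (B G C H : 'M[R]_n.+1) (k delta : R).
Local Notation Q := (dyad_sum S).
Hypothesis forms : OU_forms Q B G C H k delta.

Lemma psd_dyads_bound (M : 'M[R]_n.+1) x : nonneg_symmetric M ->
  \sum_(s <- S) bform M x s ^+ 2 <= \tr (Q *m M) * bform M x x.
Proof.
move=> psdM; rewrite -sum_bform_diag mulr_suml; apply: ler_sum => s _.
by rewrite mulrC; exact: bform_CauchySchwarz.
Qed.

(** The logarithm carries the recurrence of the neutral part, the corrector [C] the
    averaging of its noise, and [H] the contraction of the stable part. *)
Definition lyap a A (x : 'cV[R]_n.+1) : R :=
  lyap_main A (a + bform G x x) + bform C x x * lyap_corr A (a + bform G x x)
  + bform H x x * (a + bform G x x)^-1 ^+ 2.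

Definition lyap1 a A (x d : 'cV[R]_n.+1) : R :=
  let i := (a + bform G x x)^-1 in
  (i + A * i ^+ 2) * (2 * bform G x d)
  + (bform C x x * (- (2 * i ^+ 3 + 6 * A * i ^+ 4) * (2 * bform G x d))
     + (i ^+ 2 + 2 * A * i ^+ 3) * (2 * bform C x d))
  + (bform H x x * (- 2 * i ^+ 3 * (2 * bform G x d)) + i ^+ 2 * (2 * bform H x d)).

Definition lyap2 a A (x d : 'cV[R]_n.+1) : R :=
  let i := (a + bform G x x)^-1 in
  (- (i ^+ 2 + 2 * A * i ^+ 3) * (4 * bform G x d ^+ 2)
    + (i + A * i ^+ 2) * (2 * bform G d d))
  + (bform C x x * ((6 * i ^+ 4 + 24 * A * i ^+ 5) * (4 * bform G x d ^+ 2)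
       - (2 * i ^+ 3 + 6 * A * i ^+ 4) * (2 * bform G d d))
     - (2 * i ^+ 3 + 6 * A * i ^+ 4) * (8 * (bform C x d * bform G x d))
     + (i ^+ 2 + 2 * A * i ^+ 3) * (2 * bform C d d))
  + (bform H x x * (6 * i ^+ 4 * (4 * bform G x d ^+ 2) - 2 * i ^+ 3 * (2 * bform G d d))
     - 2 * i ^+ 3 * (8 * (bform H x d * bform G x d)) + i ^+ 2 * (2 * bform H d d)).

Lemma jet2_lyap a A x d : 0 < a ->
  jet2 (fun t => lyap a A (x + t *: d)) (lyap1 a A x d) (lyap2 a A x d).
Proof.
move=> a0.
have [[sG G0] sC [sH H0] _ _ _ _ _ _ _ _ _] := forms.
pose f M c t := (c + bform M x x) + (2 * bform M x d) * t + bform M d d * t ^+ 2 : R.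
have fE M c t : M^T = M -> c + bform M (x + t *: d) (x + t *: d) = f M c t.
  by move=> sM; rewrite bform_line // /f !addrA.
have jf M c : jet2 (f M c) (2 * bform M x d) (2 * bform M d d) by exact: jet2_quad.
have fG0 t : 0 < f G a t.
  by rewrite -fE //; have := G0 (x + t *: d); rewrite /bform => h; lra.
have j1 := jet2_comp (jf G a) (fun t => is_derive_lyap_main A (fG0 t))
   (is_derive_lyap_main1 A (fG0 0)).
have j2 := jet2_comp (jf G a) (fun t => is_derive_lyap_corr A (fG0 t))
   (is_derive_lyap_corr1 A (fG0 0)).
have j3 := jet2_comp (jf G a) (fun t => is_derive_invsq (fG0 t)) (is_derive_invsq1 (fG0 0)).
have j := jet2D (jet2D j1 (jet2M (jf C 0) j2)) (jet2M (jf H 0) j3).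
have -> : (fun t => lyap a A (x + t *: d)) = (fun t => lyap_main A (f G a t)
  + f C 0 t * lyap_corr A (f G a t) + f H 0 t * (f G a t)^-1 ^+ 2).
  by apply/funext => t; rewrite /lyap -[bform C _ _]add0r -[bform H _ _]add0r !fE.
have f00 M c : f M c 0 = c + bform M x x by rewrite /f mulr0 expr0n /= mulr0 !addr0.
apply: jet2_eq j _ _; rewrite !f00 !add0r /lyap1 /lyap2 /lyap_corr /=; ring.
Qed.

Lemma lyap_drift a A x :
  let i := (a + bform G x x)^-1 in
  OU_lines S B (lyap1 a A) (lyap2 a A) x =
  - (i ^+ 2 + 2 * A * i ^+ 3) * (2 * bform (G *m Q *m G) x x - 2 * bform C x (B *m x))
    + (i + A * i ^+ 2) * \tr (Q *m G)
    + bform C x x * (2 * (6 * i ^+ 4 + 24 * A * i ^+ 5) * bform (G *m Q *m G) x x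
        - (2 * i ^+ 3 + 6 * A * i ^+ 4) * \tr (Q *m G))
    - 4 * (2 * i ^+ 3 + 6 * A * i ^+ 4) * bform (C *m Q *m G) x x
    + (i ^+ 2 + 2 * A * i ^+ 3) * \tr (Q *m C)
    + bform H x x * (12 * i ^+ 4 * bform (G *m Q *m G) x x - 2 * i ^+ 3 * \tr (Q *m G))
    - 8 * i ^+ 3 * bform (H *m Q *m G) x x + i ^+ 2 * \tr (Q *m H)
    + 2 * i ^+ 2 * bform H x (B *m x).
Proof.
have [[sG _] _ _ _ _ nd _ _ _ _ _ _] := forms.
move=> i; rewrite /OU_lines.
have sB M : \sum_(s <- S) bform M x s * bform G x s = bform (M *m Q *m G) x x.
  by rewrite sum_bform_dyads sG.
rewrite -!sB -!sum_bform_diag.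
rewrite /lyap1 nd -/i.
have -> : \sum_(s <- S) lyap2 a A x s =
   - (i ^+ 2 + 2 * A * i ^+ 3) * (4 * \sum_(s <- S) bform G x s * bform G x s)
    + (i + A * i ^+ 2) * (2 * \sum_(s <- S) bform G s s)
  + (bform C x x * ((6 * i ^+ 4 + 24 * A * i ^+ 5) * (4 * \sum_(s <- S) bform G x s * bform G x s)
       - (2 * i ^+ 3 + 6 * A * i ^+ 4) * (2 * \sum_(s <- S) bform G s s))
     - (2 * i ^+ 3 + 6 * A * i ^+ 4) * (8 * (\sum_(s <- S) bform C x s * bform G x s))
     + (i ^+ 2 + 2 * A * i ^+ 3) * (2 * \sum_(s <- S) bform C s s))
  + (bform H x x * (6 * i ^+ 4 * (4 * \sum_(s <- S) bform G x s * bform G x s)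
        - 2 * i ^+ 3 * (2 * \sum_(s <- S) bform G s s))
     - 2 * i ^+ 3 * (8 * (\sum_(s <- S) bform H x s * bform G x s))
     + i ^+ 2 * (2 * \sum_(s <- S) bform H s s)).
  elim: (S) => [|s S' IH]; first by rewrite !big_nil; ring.
  by rewrite !big_cons IH /lyap2 -/i; ring.
by field.
Qed.

End LyapunovConstruction.

(** * Existence of a Lyapunov function *)

Section LyapunovExistence.
Variable R : realType.
Variables (n : nat) (S : seq 'cV[R]_n.+1) (B G C H : 'M[R]_n.+1) (k delta : R).
Local Notation Q := (dyad_sum S).
Hypothesis forms : OU_forms Q B G C H k delta.

Lemma tr_dyads_ge0 (M : 'M[R]_n.+1) : nonneg_symmetric M -> 0 <= \tr (Q *m M).
Proof.
by move=> psdM; rewrite -sum_bform_diag sumr_ge0 // => s _; exact: bform_ge0.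
Qed.

Lemma continuous_lyap a A : 0 < a -> continuous (lyap G C H a A).
Proof.
move=> a0 x; have [psdG _ _ _ _ _ _ _ _ _ _ _] := forms.
have r0 y : 0 < a + bform G y y by have := bform_ge0 psdG y; lra.
have cr : {for x, continuous (fun y => a + bform G y y)}.
  apply: (@continuousD _ _ _ (cst a) (fun y => bform G y y)).
    exact: cst_continuous.
  exact: continuous_qform.
have comp (f : R -> R) l : is_derive (a + bform G x x) 1 f l ->
    {for x, continuous (fun y => f (a + bform G y y))}.
  move=> df; apply: (@continuous_comp _ _ _ (fun y => a + bform G y y) f) => //.
  by apply/differentiable_continuous/derivable1_diffP; case: df.
have c1 := comp _ _ (is_derive_lyap_main A (r0 x)).
have c2 := comp _ _ (is_derive_lyap_corr A (r0 x)).
have c3 := comp _ _ (is_derive_invsq (r0 x)).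
have cq M : {for x, continuous (fun y => bform M y y)} by exact: continuous_qform.
exact: (continuousD (continuousD c1 (continuousM (cq C) c2)) (continuousM (cq H) c3)).
Qed.

Lemma lyap_lower_bound a A x : 1 <= a -> 0 <= A ->
  ln (a + bform G x x) - (A + k * (1 + 2 * A))
    + bform H x x * (a + bform G x x)^-1 ^+ 2 <= lyap G C H a A x.
Proof.
move=> a1 A0; have [psdG _ _ k0 _ _ _ cb _ _ _ _] := forms.
have rho0 := bform_ge0 psdG x; have {cb} cb := cb x.
rewrite /lyap /lyap_main /lyap_corr.
move: rho0 cb; set rho := bform G x x => rho0 cb; set r := a + rho.
have r1 : 1 <= r by rewrite /r; lra.
have i0 : 0 < r^-1 by rewrite invr_gt0; lra.
have i1 : r^-1 <= 1 by rewrite invf_le1 //; lra.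
have ri : r * r^-1 = 1 by rewrite mulfV // gt_eqF; lra.
have rr : rho <= r by rewrite /r; lra.
clearbody r; set i := r^-1 in i0 i1 ri *; clearbody i.
rewrite lerD2r -addrA lerD2l opprD lerD //.
  by rewrite lerN2 -[leRHS]mulr1 ler_wpM2l.
have w1 : rho * i <= 1 by rewrite -ri ler_pM2r.
have w0 : 0 <= rho * i by rewrite mulr_ge0 // ltW.
have corr0 : 0 <= i ^+ 2 + 2 * A * i ^+ 3.
  have -> : i ^+ 2 + 2 * A * i ^+ 3 = i ^+ 2 * (1 + 2 * (A * i)) by ring.
  have Ai : 0 <= A * i by rewrite mulr_ge0 // ltW.
  by apply: mulr_ge0; [exact: sqr_ge0 | lra].
have h1 : - (k * rho) <= bform C x x by move: cb; rewrite ler_norml => /andP[].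
apply: (@le_trans _ _ (- (k * rho) * (i ^+ 2 + 2 * A * i ^+ 3))); last exact: ler_wpM2r.
rewrite mulNr lerN2.
have -> : k * rho * (i ^+ 2 + 2 * A * i ^+ 3) = k * (rho * i) * (i + 2 * A * i ^+ 2) by ring.
have h2 : 0 <= i + 2 * A * i ^+ 2.
  by apply: addr_ge0; [exact: ltW | apply: mulr_ge0; [lra | exact: sqr_ge0]].
have h3 : i + 2 * A * i ^+ 2 <= 1 + 2 * A.
  apply: lerD => //; rewrite -[leRHS]mulr1; apply: ler_wpM2l; first lra.
  by apply: exprn_ile1 => //; exact: ltW.
apply: ler_pM => //; first by rewrite mulr_ge0.
by rewrite -[leRHS]mulr1 ler_wpM2l.
Qed.

(** The constants are chosen in this order: [a] large, for the decay of [H] to dominate;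
    [A] large, for the strict inequality at large [r]; the radius of the ball last. In the
    absence of a neutral part [A = a] does, since [r] is then constant. *)
Lemma exists_lyapunov : exists W, lyapunov S B W.
Proof.
have [psdG sC psdH k0 d0 nd nn cb cn sd fc nondeg] := forms.
have s0 := tr_dyads_ge0 psdG; have tH0 := tr_dyads_ge0 psdH.
pose s := \tr (Q *m G); pose tH := \tr (Q *m H); pose tC := \tr (Q *m C).
pose k' := k + `|tC| + tH + s.
have kk' : k <= k' by rewrite /k' /tH /s; have := normr_ge0 tC; lra.
have k'0 : 0 <= k' by exact: le_trans kk'.
pose a := 1 + (12 * s + 8 * k') / delta.
have a1 : 1 <= a.
  by rewrite /a lerDl divr_ge0 ?(ltW d0) // /s; lra.
pose K1 := 14 * k' * s + 18 * k'; pose K2 := 2 * s * a + 54 * k' * s + 26 * k'.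
have K10 : 0 <= K1 by rewrite /K1; have := mulr_ge0 k'0 s0; rewrite -/s; lra.
have K20 : 0 <= K2.
  have h1 := mulr_ge0 k'0 s0; have h2 : 0 <= s * a by apply: mulr_ge0 => //; lra.
  by rewrite /K2; move: h1; rewrite -/s; lra.
pose A := a + (if 0 < s then (K1 + 1) / s else 0).
have A0 : 0 <= A.
  rewrite /A; case: ifP => [sp|_]; last lra.
  have : 0 <= (K1 + 1) / s by apply: divr_ge0 => //; lra.
  by lra.
have a0 : 0 < a by lra.
have K2A0 : 0 <= K2 * A by exact: mulr_ge0.
have rho0 x := bform_ge0 psdG x; have h0 x := bform_ge0 psdH x.
exists (lyap G C H a A); split.
- exact: continuous_lyap.
- exists (- (A + k * (1 + 2 * A))) => x; apply: le_trans (lyap_lower_bound x a1 A0).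
  have l0 : 0 <= ln (a + bform G x x) by rewrite ln_ge0 //; have := rho0 x; lra.
  have : 0 <= bform H x x * (a + bform G x x)^-1 ^+ 2 by rewrite mulr_ge0 // sqr_ge0.
  by lra.
- move=> M; pose M' := M + (A + k * (1 + 2 * A)).
  exists (k * (expR M' + M' * expR M' ^+ 2)) => x WM.
  have := le_trans (lyap_lower_bound x a1 A0) WM.
  have r1 : 1 <= a + bform G x x by have := rho0 x; lra.
  have l0 : 0 <= ln (a + bform G x x) by rewrite ln_ge0.
  set r := a + bform G x x in r1 l0 * => bM.
  have r0 : 0 < r by lra.
  have hr0 : 0 <= bform H x x * r^-1 ^+ 2 by rewrite mulr_ge0 // sqr_ge0.
  have rM : r <= expR M' by rewrite -[r](lnK r0) ler_expR /M'; lra.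
  have hM : bform H x x * r^-1 ^+ 2 <= M' by rewrite /M'; lra.
  have M'0 : 0 <= M' by rewrite /M'; lra.
  apply: le_trans (fc x) _; apply: ler_wpM2l => //; apply: lerD.
    by apply: le_trans rM; rewrite /r; lra.
  have -> : bform H x x = bform H x x * r^-1 ^+ 2 * r ^+ 2.
    by rewrite -mulrA -exprMn mulVf ?expr1n ?mulr1 // gt_eqF.
  apply: ler_pM => //; first exact: sqr_ge0.
  by rewrite ler_sqr // ?nnegrE ?expR_ge0 // ltW.
exists (lyap1 G C H a A), (lyap2 G C H a A); split.
  by move=> x d; exact: jet2_lyap forms _ _ _ _ a0.
exists (k * (K2 * A + (K1 + K2 * A) / delta)).
  apply: mulr_ge0 => //; apply: addr_ge0 => //; apply: divr_ge0; last exact: ltW.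
  exact: addr_ge0.
move=> x; rewrite (lyap_drift forms) => LW.
have thE M : bform (M *m Q *m G) x x = \sum_(t <- S) bform M x t * bform G x t.
  by rewrite sum_bform_dyads; case: psdG => ->.
have theta0 : 0 <= bform (G *m Q *m G) x x.
  rewrite thE; apply: sumr_ge0 => t _.
  by rewrite -expr2 sqr_ge0.
have theta1 : bform (G *m Q *m G) x x <= s * bform G x x.
  by rewrite thE; exact: psd_dyads_bound.
have omb : `|bform (H *m Q *m G) x x| <= k' * (bform H x x + bform G x x).
  have hG := psd_dyads_bound S x psdG; have hH := psd_dyads_bound S x psdH.
  rewrite thE; apply: (@le_trans _ _ (\sum_(t <- S) (bform H x t ^+ 2 + bform G x t ^+ 2))).
    apply: le_trans (ler_norm_sum _ _ _) _; apply: ler_sum => t _.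
    by rewrite ler_norml; apply/andP; split; nra.
  rewrite big_split /=; apply: le_trans (lerD hH hG) _; rewrite mulrDr; apply: lerD.
    apply: ler_wpM2r => //; rewrite /k' -/tH; move: tH0 s0; rewrite -/tH -/s.
    by have := normr_ge0 tC; lra.
  apply: ler_wpM2r => //; rewrite /k' -/s; move: tH0 s0; rewrite -/tH -/s.
  by have := normr_ge0 tC; lra.
have mono (y : R) : `|y| <= k * bform G x x -> `|y| <= k' * bform G x x.
  by move=> h; apply: le_trans h _; apply: ler_wpM2r.
have tCk : tC <= k' by rewrite /k' /tH /s; have := ler_norm tC; lra.
have tHk : tH <= k' by rewrite /k' /tH /s; have := normr_ge0 tC; move: tH0; rewrite -/tH; lra.
have da : 12 * s + 8 * k' <= delta * a.
  have -> : delta * a = delta + (12 * s + 8 * k').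
    by rewrite /a; field; rewrite gt_eqF.
  by rewrite lerDr ltW.
have := lyapunov_drift_estimate k'0 d0 s0 a1 A0 (rho0 x) (h0 x) erefl theta0 theta1
  (nn x) (mono _ (cb x)) (mono _ (cn x)) tCk tHk omb (sd x) da LW.
rewrite -/s -/K1 -/K2.
have r1 : 1 <= a + bform G x x by have := rho0 x; lra.
have i0 : 0 < (a + bform G x x)^-1 by rewrite invr_gt0; lra.
have i1 : (a + bform G x x)^-1 <= 1 by rewrite invf_le1 //; lra.
set i := (a + bform G x x)^-1 in i0 i1 *.
have K2Ai : K2 * A * i <= K2 * A by rewrite -[leRHS]mulr1 ler_wpM2l.
move=> est; apply: le_trans (fc x) _; apply: ler_wpM2l => //; apply: lerD; last first.
  rewrite ler_pdivlMr // mulrC; apply: le_trans est _.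
  suff : 0 <= s * (A - a) by move: K2Ai; lra.
  apply: mulr_ge0 => //; rewrite /A; case: ifP => [sp|_]; last lra.
  have : 0 <= (K1 + 1) / s by apply: divr_ge0 => //; lra.
  by lra.
case: nondeg => [sp|->//].
have sA : s * (A - a) = K1 + 1.
  rewrite /A sp addrC addKr mulrC divfK // gt_eqF //.
have : 1 <= K2 * A * i.
  have : 0 <= delta * bform H x x by apply: mulr_ge0 => //; exact: ltW.
  by move: est; rewrite mulNr sA; lra.
move=> h1; apply: (@le_trans _ _ (a + bform G x x)); first lra.
have -> : a + bform G x x = 1 / i by rewrite /i div1r invrK.
by rewrite ler_pdivrMr.
Qed.

End LyapunovExistence.

(** * Quadratic forms for stable matrices *)

Section StableForm.
Variable R : realType.

Lemma bform_diag m (D : 'rV[R]_m) x y :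
  bform (diag_mx D) x y = \sum_i D 0 i * (x i 0 * y i 0).
Proof.
rewrite /bform mxE; apply: eq_bigr => i _; rewrite mul_mx_diag !mxE; ring.
Qed.

(** Conjugating a triangular matrix by [diag (e^j)] multiplies the entries below the
    diagonal by at least one factor [e], so that for small [e] the diagonal decides
    the sign of the form. The complex matrix is [Tr + i Ti], the vector [a + i b]. *)
Lemma triangular_form m (Tr Ti : 'M[R]_m) :
  (forall i j : 'I_m, (i < j)%N -> Tr i j = 0 /\ Ti i j = 0) ->
  (forall i, Tr i i < 0) ->
  exists D : 'rV[R]_m, exists delta : R, [/\ 0 < delta, forall i, 0 < D 0 i &
   forall a b : 'cV[R]_m,
     bform (diag_mx D) a (Tr *m a - Ti *m b) + bform (diag_mx D) b (Tr *m b + Ti *m a)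
     <= - delta * (bform (diag_mx D) a a + bform (diag_mx D) b b)].
Proof.
move=> trig neg.
(* The inverse of a sum of inverses is smaller than each [- Tr j j]. *)
pose delta := 2^-1 / (1 + \sum_j (- Tr j j)^-1).
have sum0 : 0 <= \sum_j (- Tr j j)^-1.
  by apply: sumr_ge0 => j _; rewrite invr_ge0 oppr_ge0 ltW.
have delta0 : 0 < delta by rewrite divr_gt0 // ?invr_gt0 //; lra.
have deltaP j : Tr j j <= - 2 * delta.
  have h : (- Tr j j)^-1 <= 1 + \sum_j (- Tr j j)^-1.
    rewrite (bigD1 j) //= addrCA lerDl addr_ge0 // sumr_ge0 // => i _.
    by rewrite invr_ge0 oppr_ge0 ltW.
  have p : 0 < - Tr j j by rewrite oppr_gt0.
  have : (1 + \sum_j (- Tr j j)^-1)^-1 <= - Tr j j.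
    by rewrite -[leRHS]invrK lef_pV2 // posrE ?invr_gt0 //; lra.
  by rewrite /delta; set z := (_ + _)^-1; lra.
pose t : R := \sum_i \sum_j (`|Tr i j| + `|Ti i j|).
have tP i j : `|Tr i j| + `|Ti i j| <= t.
  rewrite /t (bigD1 i) //= (bigD1 j) //= -addrA lerDl addr_ge0 //.
    by apply: sumr_ge0 => l _; exact: addr_ge0.
  by apply: sumr_ge0 => l _; apply: sumr_ge0 => l' _; exact: addr_ge0.
have t0 : 0 <= t.
  by apply: sumr_ge0 => l _; apply: sumr_ge0 => l' _; exact: addr_ge0.
pose e := delta / (2 * m%:R * t + delta + 1).
have mt0 : 0 <= 2 * m%:R * t by rewrite !mulr_ge0.
have den0 : 0 < 2 * m%:R * t + delta + 1 by lra.
have e0 : 0 < e by rewrite divr_gt0.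
have e1 : e <= 1 by rewrite ler_pdivrMr //; lra.
have eP : 2 * m%:R * t * e <= delta.
  rewrite /e mulrA ler_pdivrMr // mulrC ler_wpM2l ?(ltW delta0) //; lra.
exists (\row_j e ^+ (2 * j)), delta; split => // [i|a b]; first by rewrite mxE exprn_gt0.
set D := \row_j _; pose mm j := D 0 j * (a j 0 ^+ 2 + b j 0 ^+ 2).
have D0 j : 0 < D 0 j by rewrite mxE exprn_gt0.
have mm0 j : 0 <= mm j.
  by apply: mulr_ge0; [exact: ltW | apply: addr_ge0; exact: sqr_ge0].
have -> : bform (diag_mx D) a a + bform (diag_mx D) b b = \sum_j mm j.
  by rewrite !bform_diag -big_split /=; apply: eq_bigr => j _; rewrite /mm; ring.
have -> : bform (diag_mx D) a (Tr *m a - Ti *m b) + bform (diag_mx D) b (Tr *m b + Ti *m a)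
  = \sum_j \sum_i D 0 j * (Tr j i * (a j 0 * a i 0 + b j 0 * b i 0)
      + Ti j i * (b j 0 * a i 0 - a j 0 * b i 0)).
  rewrite !bform_diag -big_split /=; apply: eq_bigr => j _.
  rewrite !mxE -!mulr_sumr -mulrDr; congr (_ * _).
  under [RHS]eq_bigr do rewrite mulrDr mulrBr.
  rewrite mulrBr mulrDr !mulr_sumr -!sumrN -!big_split /=.
  by apply: eq_bigr => i _; ring.
have entry j i : D 0 j * (Tr j i * (a j 0 * a i 0 + b j 0 * b i 0)
      + Ti j i * (b j 0 * a i 0 - a j 0 * b i 0))
   <= (i == j)%:R * (- 2 * delta) * mm j + e * t * (mm j + mm i).
  have off0 : 0 <= e * t * (mm j + mm i).
    by apply: mulr_ge0; [apply: mulr_ge0 => //; exact: ltW | exact: addr_ge0].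
  have [ij|ji|/val_inj ij] := ltngtP (val i) (val j).
  - have -> : (i == j) = false by apply/negbTE; rewrite -val_eqE /= ltn_eqF.
    rewrite !mul0r add0r.
    pose u (l : 'I_m) : R := e ^+ l * a l 0; pose w (l : 'I_m) : R := e ^+ l * b l 0.
    have mmE l : mm l = u l ^+ 2 + w l ^+ 2.
      by rewrite /mm /u /w /D mxE mulnC exprM; ring.
    have -> : D 0 j * (Tr j i * (a j 0 * a i 0 + b j 0 * b i 0)
      + Ti j i * (b j 0 * a i 0 - a j 0 * b i 0)) =
      e ^+ (j - i) * (Tr j i * (u j * u i + w j * w i) + Ti j i * (w j * u i - u j * w i)).
      have -> : D 0 j = e ^+ (j - i) * e ^+ j * e ^+ i.
        by rewrite mxE mulrAC -exprD subnK ?(ltnW ij) // -exprD mul2n addnn.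
      by rewrite /u /w; ring.
    have ex0 : 0 <= e ^+ (j - i) by rewrite exprn_ge0 // ltW.
    have exe : e ^+ (j - i) <= e.
      by apply: ler_iXnr => //; [rewrite subn_gt0 | exact: ltW].
    rewrite !mmE; have := tP j i.
    set X := u j; set X' := u i; set Y := w j; set Y' := w i => tt.
    have b1 : `|X * X' + Y * Y'| <= X ^+ 2 + Y ^+ 2 + (X' ^+ 2 + Y' ^+ 2).
      have := sqr_ge0 (X - X'); have := sqr_ge0 (X + X').
      have := sqr_ge0 (Y - Y'); have := sqr_ge0 (Y + Y').
      by rewrite ler_norml => *; apply/andP; split; lra.
    have b2 : `|Y * X' - X * Y'| <= X ^+ 2 + Y ^+ 2 + (X' ^+ 2 + Y' ^+ 2).
      have := sqr_ge0 (Y - X'); have := sqr_ge0 (Y + X').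
      have := sqr_ge0 (X - Y'); have := sqr_ge0 (X + Y').
      by rewrite ler_norml => *; apply/andP; split; lra.
    set N := _ + _ + (_ + _) in b1 b2 *.
    have N0 : 0 <= N by apply: le_trans b1.
    have b3 : Tr j i * (X * X' + Y * Y') + Ti j i * (Y * X' - X * Y') <= t * N.
      apply: le_trans (ler_norm _) _; apply: le_trans (ler_normD _ _) _.
      rewrite !normrM; apply: (@le_trans _ _ ((`|Tr j i| + `|Ti j i|) * N)).
        by rewrite mulrDl; apply: lerD; apply: ler_wpM2l.
      by apply: ler_wpM2r.
    apply: (@le_trans _ _ (e ^+ (j - i) * (t * N))); first by apply: ler_wpM2l.
    by rewrite -mulrA; apply: ler_wpM2r => //; apply: mulr_ge0.
  - have [-> ->] := trig j i ji; rewrite !mul0r addr0 mulr0.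
    have -> : (i == j) = false by apply/negbTE; rewrite -val_eqE /= gtn_eqF.
    by rewrite !mul0r add0r.
  - move: off0; rewrite ij eqxx mul1r => off0.
    have -> : D 0 j * (Tr j j * (a j 0 * a j 0 + b j 0 * b j 0)
      + Ti j j * (b j 0 * a j 0 - a j 0 * b j 0)) = Tr j j * mm j by rewrite /mm; ring.
    by have := ler_wpM2r (mm0 j) (deltaP j); lra.
apply: le_trans (ler_sum _ (fun j _ => ler_sum _ (fun i _ => entry j i))) _.
have -> : \sum_j \sum_i ((i == j)%:R * (- 2 * delta) * mm j + e * t * (mm j + mm i))
  = - 2 * delta * (\sum_j mm j) + 2 * m%:R * t * e * (\sum_j mm j).
  under eq_bigr => j _ do rewrite big_split /=.
  rewrite big_split /=; congr (_ + _).
    rewrite mulr_sumr; apply: eq_bigr => j _; rewrite (bigD1 j) //= eqxx mul1r.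
    by rewrite big1 ?addr0 // => i /negbTE ->; rewrite !mul0r.
  set M := \sum_j mm j.
  have inner (j : 'I_m) : \sum_i e * t * (mm j + mm i) = e * t * (m%:R * mm j + M).
    by rewrite -mulr_sumr big_split /= sumr_const card_ord mulr_natl.
  rewrite (eq_bigr _ (fun j _ => inner j)) -mulr_sumr big_split /= -mulr_sumr -/M.
  by rewrite sumr_const card_ord -(mulr_natl M); ring.
have s0 : 0 <= \sum_j mm j by apply: sumr_ge0.
by have := ler_wpM2r s0 eP; lra.
Qed.

End StableForm.

Section Schur.
Variable R : realType.
Local Notation C := (R[i]).
Local Notation Rem := (map_mx (@complex.Re R)).
Local Notation Imm := (map_mx (@complex.Im R)).

Lemma Re_sum (I : Type) (r : seq I) (F : I -> C) :
  complex.Re (\sum_(i <- r) F i) = \sum_(i <- r) complex.Re (F i).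
Proof. by elim/big_rec2: _ => // i y x _ <-; case: (F i) x => [? ?] []. Qed.

Lemma Im_sum (I : Type) (r : seq I) (F : I -> C) :
  complex.Im (\sum_(i <- r) F i) = \sum_(i <- r) complex.Im (F i).
Proof. by elim/big_rec2: _ => // i y x _ <-; case: (F i) x => [? ?] []. Qed.

Lemma Re_mulmx m n p (A : 'M[C]_(m, n)) (B : 'M[C]_(n, p)) :
  Rem (A *m B) = Rem A *m Rem B - Imm A *m Imm B.
Proof.
apply/matrixP => i j; rewrite !mxE Re_sum -sumrN -big_split /=.
by apply: eq_bigr => l _; rewrite !mxE; case: (A i l) (B l j) => [? ?] [].
Qed.

Lemma Im_mulmx m n p (A : 'M[C]_(m, n)) (B : 'M[C]_(n, p)) :
  Imm (A *m B) = Rem A *m Imm B + Imm A *m Rem B.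
Proof.
apply/matrixP => i j; rewrite !mxE Im_sum -big_split /=.
by apply: eq_bigr => l _; rewrite !mxE; case: (A i l) (B l j) => [? ?] [].
Qed.

Lemma stable_triangularization m (B : 'M[R]_m) : stable_mx B ->
  exists X Y V W Tr Ti : 'M[R]_m,
   [/\ forall i j : 'I_m, (i < j)%N -> Tr i j = 0 /\ Ti i j = 0,
       forall i, Tr i i < 0, X *m B = Tr *m X - Ti *m Y,
       Y *m B = Tr *m Y + Ti *m X & V *m X - W *m Y = 1%:M].
Proof.
move=> stB; pose Bc := map_mx (real_complex R) B.
have [m0|m0] := posnP m.
  have no (i : 'I_m) : False by have := leq_ltn_trans (leq0n i) (ltn_ord i); rewrite lt0n m0.
  exists 0, 0, 0, 0, 0, 0; split => [i|i|||]; try by case: (no i).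
  1-3: by apply/matrixP => i; case: (no i).
have [U Uu trigU] := Schur Bc m0.
have Uunit := unitarymx_unit Uu.
move: trigU; rewrite /similar_to /= conjumx // => /is_trig_mxP trigU.
set T := U *m Bc *m invmx U in trigU.
have UB : U *m Bc = T *m U by rewrite /T mulmxKV.
clearbody T.
have ReB : Rem Bc = B by apply/matrixP => i j; rewrite !mxE.
have ImB : Imm Bc = 0 by apply/matrixP => i j; rewrite !mxE.
exists (Rem U), (Imm U), (Rem (invmx U)), (Imm (invmx U)), (Rem T), (Imm T); split.
- by move=> i j ij; split; rewrite mxE trigU.
- move=> i; rewrite mxE; apply: stB; apply/eigenvalueP.
  have : eigenvalue T (T i i).
    rewrite eigenvalue_root_char char_poly_trig; last exact/is_trig_mxP.
    by rewrite rootE horner_prod (bigD1 i) //= hornerXsubC subrr mul0r.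
  move=> /eigenvalueP [w wT w0]; exists (w *m U).
    by rewrite -mulmxA UB mulmxA wT scalemxAl.
  by apply: contraNneq w0 => wU; rewrite -[w](mulmxK Uunit) wU mul0mx.
- by have := congr1 (fun M => Rem M) UB; rewrite !Re_mulmx ReB ImB mulmx0 subr0.
- by have := congr1 (fun M => Imm M) UB; rewrite !Im_mulmx ReB ImB mulmx0 add0r.
- have := congr1 (fun M => Rem M) (mulVmx Uunit); rewrite Re_mulmx => e.
  by apply: etrans e _; apply/matrixP => i j; rewrite !mxE; case: (i == j).
Qed.

(** The Lyapunov theorem: a stable linear drift contracts some scalar product. *)
Lemma stable_mx_form m (B : 'M[R]_m) : stable_mx B ->
  exists H : 'M[R]_m, exists delta k : R, [/\ nonneg_symmetric H, 0 < delta, 0 <= k,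
    forall x, bform H x (B *m x) <= - delta * bform H x x &
    forall x, bform 1%:M x x <= k * bform H x x].
Proof.
move=> /stable_triangularization [X [Y [V [W [Tr [Ti [trig neg XB YB VW]]]]]]].
have [D [delta [d0 D0 dP]]] := triangular_form trig neg.
pose H := X^T *m diag_mx D *m X + Y^T *m diag_mx D *m Y.
have HE x y : bform H x y = bform (diag_mx D) (X *m x) (X *m y)
                          + bform (diag_mx D) (Y *m x) (Y *m y).
  by rewrite /H bformDm !bform_mulmxr !bform_mulmxl !mulmxA.
have Dge0 x : 0 <= bform (diag_mx D) x x.
  rewrite bform_diag sumr_ge0 // => i _; rewrite -expr2.
  by apply: mulr_ge0; [exact: ltW | exact: sqr_ge0].
have [kV kV0 kVP] := bform_bound (V^T *m V); have [kW kW0 kWP] := bform_bound (W^T *m W).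
pose d := 1 + \sum_i (D 0 i)^-1.
have sum0 : 0 <= \sum_i (D 0 i)^-1 by apply: sumr_ge0 => i _; rewrite invr_ge0 ltW.
have dx x : bform 1%:M x x <= d * bform (diag_mx D) x x.
  rewrite bform_diag mulr_sumr /bform mulmx1 mxE; apply: ler_sum => i _.
  rewrite mxE -expr2 mulrA -[leLHS]mul1r; apply: ler_wpM2r; first exact: sqr_ge0.
  rewrite -(mulVf (lt0r_neq0 (D0 i))) ler_pM2r // /d (bigD1 i) //= addrCA lerDl.
  by rewrite addr_ge0 // sumr_ge0 // => j _; rewrite invr_ge0 ltW.
exists H, delta, (2 * (kV + kW) * d); split => //.
- split; first by rewrite /H linearD /= !trmx_mul !trmxK tr_diag_mx !mulmxA.
  by move=> x; have := HE x x; rewrite {1}/bform => ->; apply: addr_ge0.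
- by rewrite !mulr_ge0 // ?addr_ge0 // /d; lra.
- move=> x; rewrite !HE !mulmxA XB YB !(mulmxDl, mulNmx) -!mulmxA.
  exact: dP.
- move=> x; rewrite HE.
  have xE : x = V *m (X *m x) - W *m (Y *m x).
    by rewrite !mulmxA -mulmxBl VW mul1mx.
  set a := X *m x in xE *; set b := Y *m x in xE *.
  have va : bform 1%:M (V *m a) (V *m a) <= kV * bform 1%:M a a.
    by rewrite bform_mulmxl bform_mulmxr mulmx1; apply: le_trans (kVP a); exact: ler_norm.
  have wb : bform 1%:M (W *m b) (W *m b) <= kW * bform 1%:M b b.
    by rewrite bform_mulmxl bform_mulmxr mulmx1; apply: le_trans (kWP b); exact: ler_norm.
  have par : bform 1%:M x x <= 2 * bform 1%:M (V *m a) (V *m a) + 2 * bform 1%:M (W *m b) (W *m b).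
    rewrite xE; have := bform1_ge0 (V *m a + W *m b).
    rewrite !(bformDl, bformDr, bformNl, bformNr).
    rewrite [bform _ (W *m b) (V *m a)]bform_tr trmx1; lra.
  have la := dx a; have lb := dx b.
  have h1 := ler_wpM2l kV0 la; have h2 := ler_wpM2l kW0 lb.
  have pa := Dge0 a; have pb := Dge0 b; have d1 : 0 <= d by rewrite /d; lra.
  have h3 := mulr_ge0 kW0 (mulr_ge0 d1 pa); have h4 := mulr_ge0 kV0 (mulr_ge0 d1 pb).
  by lra.
Qed.

End Schur.

(** * Quadratic forms for the neutral block *)

Section CriticalForms.
Variable R : realType.

Lemma nonneg_symmetric_ker n (Q : 'M[R]_n) x :
  nonneg_symmetric Q -> bform Q x x = 0 -> Q *m x = 0.
Proof.
move=> psdQ Qx; apply: bform1_eq0.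
have := bform_CauchySchwarz psdQ x (Q *m x); rewrite Qx mul0r => h.
have /eqP : bform Q x (Q *m x) ^+ 2 = 0 by apply/eqP; rewrite eq_le h sqr_ge0.
by rewrite sqrf_eq0 => /eqP <-; case: psdQ => sQ _; rewrite bform_mulmxl mulmx1 sQ.
Qed.

Lemma nonneg_symmetric_congr m n (Q : 'M[R]_n) (Z : 'M[R]_(m, n)) :
  nonneg_symmetric Q -> nonneg_symmetric (Z *m Q *m Z^T).
Proof.
move=> [sQ Q0]; split; first by rewrite !trmx_mul trmxK sQ mulmxA.
by move=> x; have := Q0 (Z^T *m x); rewrite trmx_mul trmxK !mulmxA.
Qed.

Lemma nonneg_symmetric_tr n (Q : 'M[R]_n) :
  nonneg_symmetric Q -> 0 <= \tr Q /\ (\tr Q = 0 -> Q = 0).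
Proof.
move=> psdQ; have Qi i : 0 <= Q i i by rewrite -(bform_delta Q) bform_ge0.
split; first exact: sumr_ge0.
move=> /eqP; rewrite psumr_eq0 // => /allP Q0; apply/matrixP => i j; rewrite mxE.
have Qii : Q i i = 0 by apply/eqP; apply: Q0; rewrite mem_index_enum.
have := nonneg_symmetric_ker psdQ (x := delta_mx i 0).
rewrite bform_delta Qii => /(_ erefl) /(congr1 (fun M : 'cV[R]_n => M j 0)).
by rewrite -colE !mxE => Qji; case: psdQ => /(congr1 (fun M : 'M[R]_n => M j i)); rewrite mxE => ->.
Qed.

Lemma nonneg_symmetric_norm n (Q : 'M[R]_n) x : nonneg_symmetric Q ->
  bform 1%:M (Q *m x) (Q *m x) <= \tr Q * bform Q x x.
Proof.
move=> psdQ; rewrite {1}/bform mulmx1 mxE mulr_suml; apply: ler_sum => i _.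
have E : (Q *m x) i 0 = bform Q (delta_mx i 0) x.
  by rewrite /bform trmx_delta -mulmxA -rowE [RHS]mxE.
rewrite [X in X * _]mxE E -expr2 -(bform_delta Q i i); exact: bform_CauchySchwarz.
Qed.

Lemma bform0m n (x y : 'cV[R]_n) : bform (0 : 'M[R]_n) x y = 0.
Proof. by rewrite /bform mulmx0 mul0mx mxE. Qed.

Lemma bform0r n (M : 'M[R]_n) (x : 'cV[R]_n) : bform M x 0 = 0.
Proof. by rewrite bform_tr bform0l. Qed.

Lemma bform2 (M : 'M[R]_2) x y : bform M x y =
  x 0 0 * M 0 0 * y 0 0 + x 0 0 * M 0 1 * y 1 0
  + (x 1 0 * M 1 0 * y 0 0 + x 1 0 * M 1 1 * y 1 0).
Proof.
rewrite bformE !big_ord_recl !big_ord0 !addr0.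
by have -> : lift ord0 ord0 = 1 :> 'I_2 by apply/val_inj.
Qed.

Lemma rotation_generator_col (a : R) (x : 'cV[R]_2) :
  (rotation_generator a *m x) 0 0 = - a * x 1 0 /\
  (rotation_generator a *m x) 1 0 = a * x 0 0.
Proof.
have i1 : lift ord0 ord0 = 1 :> 'I_2 by apply/val_inj.
have e0 : (0 : 'I_2) = @lshift 1 1 0 by apply/val_inj.
have e1 : (1 : 'I_2) = @rshift 1 1 0 by apply/val_inj.
have b00 : rotation_generator a 0 0 = 0.
  by rewrite e0; apply: etrans (block_mxEul _ _ _ _ _ _) _; rewrite mxE.
have b01 : rotation_generator a 0 1 = - a.
  by rewrite e0 e1; apply: etrans (block_mxEur _ _ _ _ _ _) _; rewrite mxE.
have b10 : rotation_generator a 1 0 = a.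
  by rewrite e0 e1; apply: etrans (block_mxEdl _ _ _ _ _ _) _; rewrite mxE.
have b11 : rotation_generator a 1 1 = 0.
  by rewrite e1; apply: etrans (block_mxEdr _ _ _ _ _ _) _; rewrite mxE.
split; rewrite mxE !big_ord_recl big_ord0 addr0 i1 -[ord0]/(0 : 'I_2).
  by rewrite b00 b01 mul0r add0r.
by rewrite b10 b11 mul0r addr0.
Qed.

Lemma rotation_generator0 : rotation_generator (0 : R) = 0.
Proof. by rewrite /rotation_generator oppr0 -scalemx1 scale0r block_mx0. Qed.

(** The neutral form and the corrector in the neutral coordinates. Without rotation
    the form is the inverse of the noise covariance [Q], which becomes isotropic for
    it. With rotation it has to be the Euclidean one, and [C] is the solution of the
    linear equation that makes the required inequality an equality. *)
Definition rotation_corrector (Q : 'M[R]_2) (a : R) : 'M[R]_2 :=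
  \matrix_(i, j) (if i == j then (if i == 0 then - Q 0 1 / a else Q 0 1 / a)
                  else (Q 0 0 - Q 1 1) / (2 * a)).

Lemma critical_block_forms m (B Q : 'M[R]_m) :
  critical_block B -> nonneg_symmetric Q -> (B = 0 -> Q \in unitmx) ->
  ((0 < m)%N -> 0 < \tr Q) ->
  exists G C : 'M[R]_m, exists k : R,
   [/\ nonneg_symmetric G, C^T = C, 0 <= k,
    forall x, bform G x (B *m x) = 0 &
    [/\ forall x, \tr (Q *m G) * bform G x x + 2 * bform C x (B *m x)
                    <= 2 * bform (G *m Q *m G) x x,
     forall x, `|bform C x x| <= k * bform G x x,
     forall x, `|bform (C *m Q *m G) x x| <= k * bform G x x,
     forall x, bform 1%:M x x <= k * bform G x x &
     0 < \tr (Q *m G) \/ forall x, bform G x x = 0]].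
Proof.
have noise_free (l : nat) (K : 'M[R]_l) : (l <= 2)%N -> nonneg_symmetric K -> K \in unitmx ->
  exists G C : 'M[R]_l, exists k : R,
   [/\ nonneg_symmetric G, C^T = C, 0 <= k,
    forall x, bform G x (0 *m x) = 0 &
    [/\ forall x, \tr (K *m G) * bform G x x + 2 * bform C x (0 *m x)
                    <= 2 * bform (G *m K *m G) x x,
     forall x, `|bform C x x| <= k * bform G x x,
     forall x, `|bform (C *m K *m G) x x| <= k * bform G x x,
     forall x, bform 1%:M x x <= k * bform G x x &
     0 < \tr (K *m G) \/ forall x, bform G x x = 0]].
  move=> l2 psdK uK; have [sK K0] := psdK.
  have sG : (invmx K)^T = invmx K by rewrite trmx_inv sK.
  have GE x : bform (invmx K) x x = bform K (invmx K *m x) (invmx K *m x).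
    by rewrite bform_mulmxl bform_mulmxr sG mulVmx // mul1mx.
  have psdG : nonneg_symmetric (invmx K).
    by split=> // x; have := GE x; rewrite {1}/bform => ->; exact: bform_ge0.
  have [kK kK0 kKP] := bform_bound (K *m K).
  have [S KS] := nonneg_symmetric_dyads psdK.
  have tr0 : 0 <= \tr K by case: (nonneg_symmetric_tr psdK).
  exists (invmx K), 0, (\tr K); split => //; first exact: trmx0.
    by move=> x; rewrite mul0mx bform0r.
  split.
  - move=> x; rewrite mul0mx !bform0r mulr0 addr0.
    rewrite mulmxV // mulVmx // mul1mx mxtrace1; apply: ler_wpM2r; first exact: bform_ge0.
    by rewrite ler_nat.
  - by move=> x; rewrite bform0m normr0 mulr_ge0 // bform_ge0.
  - by move=> x; rewrite !mul0mx bform0m normr0 mulr_ge0 // bform_ge0.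
  - move=> x; rewrite GE; set w := invmx K *m x.
    have -> : x = K *m w by rewrite /w mulmxA mulmxV // mul1mx.
    exact: nonneg_symmetric_norm.
  - rewrite mulmxV // mxtrace1; have [l0|l0] := posnP l; last by left; rewrite ltr0n.
    right=> x; rewrite bformE big1 // => i _.
    by exfalso; move: (leq_ltn_trans (leq0n i) (ltn_ord i)); rewrite l0.
move=> cB; move: Q; case: cB => {m B}[B|Q|a Q].
- move=> Q psdQ uQ _; have -> : B = 0 by apply/matrixP => -[].
  by apply: noise_free => //; apply: uQ; apply/matrixP => -[].
- by move=> psdQ uQ _; apply: noise_free => //; exact: uQ.
- move=> psdQ uQ trQ; have [a0|a0] := eqVneq a 0.
    by move: uQ; rewrite a0 rotation_generator0 => uQ; apply: noise_free => //; exact: uQ.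
  pose C := rotation_corrector Q a.
  have Q10 : Q 1 0 = Q 0 1 by case: psdQ => + _ => /(congr1 (fun M : 'M[R]_2 => M 0 1)); rewrite mxE.
  have [kC kC0 kCP] := bform_bound C; have [kD kD0 kDP] := bform_bound (C *m Q *m 1%:M).
  have one0 x := bform1_ge0 x : 0 <= bform (1%:M : 'M[R]_2) x x.
  exists 1%:M, C, (1 + kC + kD); split.
  + by split; [exact: trmx1 | move=> x; have := one0 x].
  + by apply/matrixP => i j; rewrite !mxE eq_sym; case: eqP => // ->.
  + by lra.
  + move=> x; have [x0 x1] := rotation_generator_col a x.
    rewrite bform2 x0 x1 !mxE /=; ring.
  split.
  + move=> x; have [x0 x1] := rotation_generator_col a x.
    rewrite mulmx1 mul1mx mulmx1 !bform2 x0 x1 Q10 !mxE /=.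
    have -> : \tr Q = Q 0 0 + Q 1 1.
      rewrite /mxtrace !big_ord_recl big_ord0 addr0.
      by have -> : lift ord0 ord0 = 1 :> 'I_2 by apply/val_inj.
    by rewrite le_eqVlt; apply/orP; left; apply/eqP; field.
  + move=> x; apply: le_trans (kCP x) _; apply: ler_wpM2r => //; lra.
  + move=> x; apply: le_trans (kDP x) _; apply: ler_wpM2r => //; lra.
  + by move=> x; rewrite -[leLHS]mul1r; apply: ler_wpM2r => //; lra.
  + by left; rewrite mulmx1; exact: trQ.
Qed.

End CriticalForms.

(** * Quadratic forms from the real Jordan form *)

Section JordanForms.
Variable R : realType.

(** The Kalman rank condition in its dual form: no non-zero linear functional is
    annihilated by all the blocks. *)
Definition kalman_dual n (Q B : 'M[R]_n) :=
  forall w : 'rV[R]_n, (forall j : nat, w *m (B ^+ j) *m Q = 0) -> w = 0.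

Lemma kalman_mx_dual n (Q B : 'M[R]_n.+1) :
  \rank (kalman_mx Q B) = n.+1 -> kalman_dual Q B.
Proof.
move=> rk w wQ; have free : row_free (kalman_mx Q B) by rewrite /row_free rk.
apply: (row_free_inj free); rewrite mul0mx /kalman_mx mul_mxrow.
apply/eqP; rewrite -subr_eq0 subr0; apply/eqP.
rewrite (_ : (fun j : 'I_n.+1 => _) = (fun=> 0)); last first.
  by apply/funext => j; rewrite mulmxA wQ.
by apply/matrixP => i j; rewrite !mxE.
Qed.

(** The functionals [w Z] on the neutral coordinates form an invariant space. If such a
    functional is annihilated by [Q], and if [B] vanishes on that space or if all of them
    are annihilated, then the blocks annihilate it. *)
Lemma kalman_neutral m n (Q B : 'M[R]_n) (Z : 'M[R]_(m, n)) (B1 : 'M[R]_m) :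
  nonneg_symmetric Q -> kalman_dual Q B -> Z *m B = B1 *m Z ->
  (forall w : 'rV_m, w *m Z = 0 -> w = 0) ->
  (B1 = 0 -> Z *m Q *m Z^T \in unitmx) /\ ((0 < m)%N -> 0 < \tr (Z *m Q *m Z^T)).
Proof.
move=> psdQ kal ZB Zfree.
have psdZ := nonneg_symmetric_congr Z psdQ.
have ZBj j : Z *m B ^+ j = B1 ^+ j *m Z.
  elim: j => [|j IH]; first by rewrite !expr0 mulmx1 mul1mx.
  by rewrite !exprS -!mulmxE mulmxA ZB -mulmxA IH mulmxA.
have ZQ (w : 'rV_m) : w *m (Z *m Q *m Z^T) = 0 -> w *m Z *m Q = 0.
  move=> wQ; have : bform Q (w *m Z)^T (w *m Z)^T = 0.
    rewrite /bform trmxK trmx_mul.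
    have -> : w *m Z *m Q *m (Z^T *m w^T) = w *m (Z *m Q *m Z^T) *m w^T by rewrite !mulmxA.
    by rewrite wQ mul0mx mxE.
  move=> /(nonneg_symmetric_ker psdQ) /(congr1 trmx); rewrite trmx_mul trmxK trmx0.
  by case: psdQ => ->.
split=> [B10|m0].
  rewrite -row_free_unit -kermx_eq0; apply/eqP/row_matrixP => i; rewrite row0.
  set w := row i _; have wQ : w *m (Z *m Q *m Z^T) = 0.
    by rewrite /w -row_mul mulmx_ker row0.
  apply: Zfree; apply: kal => -[|j]; first by rewrite expr0 mulmx1 ZQ.
  by rewrite -[w *m Z *m _]mulmxA ZBj B10 expr0n /= mul0mx mulmx0 mul0mx.
have [t0 tE] := nonneg_symmetric_tr psdZ; rewrite lt_neqAle t0 andbT eq_sym.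
apply/eqP => /tE Q0.
have : delta_mx 0 (Ordinal m0) = 0 :> 'rV[R]_m.
  apply: Zfree; apply: kal => j.
  rewrite -[_ *m Z *m _]mulmxA ZBj mulmxA ZQ // Q0 mulmx0 //.
by move=> /(congr1 (fun M : 'rV_m => M 0 (Ordinal m0))) /eqP; rewrite !mxE !eqxx oner_eq0.
Qed.

(** All forms are pulled back from the two blocks of coordinates of [P x]. *)
Lemma recurrent_Jordan_forms n (Q B : 'M[R]_n) :
  nonneg_symmetric Q -> kalman_dual Q B -> recurrent_Jordan B ->
  exists G C H : 'M[R]_n, exists k delta : R, OU_forms Q B G C H k delta.
Proof.
move=> + + [k [m [e [B0 [B1 [P [uP PB st cB]]]]]]].
case: n / e Q B P uP PB => Q B P uP; rewrite castmx_id => PB psdQ kal.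
pose Y := usubmx P; pose Z := dsubmx P.
have PE : P = col_mx Y Z by rewrite vsubmxK.
have : P *m B = block_mx B0 0 0 B1 *m P by rewrite -PB mulmxKV.
rewrite {1 2}PE mul_col_mx mul_block_col !mul0mx addr0 add0r => /eq_col_mx [YB ZB].
have Zfree (w : 'rV_m) : w *m Z = 0 -> w = 0.
  move=> wZ; have : row_mx 0 w *m P = 0 by rewrite PE mul_row_col mul0mx add0r.
  move=> /(congr1 (fun M => M *m invmx P)); rewrite mulmxK // mul0mx => h.
  by have := congr1 rsubmx h; rewrite row_mxKr linear0.
have [unitZ trZ] := kalman_neutral psdQ kal ZB Zfree.
have psdZ := nonneg_symmetric_congr Z psdQ.
have [G [C [kz [psdG sC kz0 nd [nn cb cn nk nondeg]]]]] :=
  critical_block_forms cB psdZ unitZ trZ.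
have [H [delta [ky [psdH d0 ky0 sd sk]]]] := stable_mx_form st.
have [kp kp0 kpP] := bform_bound ((invmx P)^T *m invmx P).
have pull l (M : 'M[R]_l) (K : 'M[R]_(l, k + m)) x y :
    bform (K^T *m M *m K) x y = bform M (K *m x) (K *m y).
  by rewrite bform_mulmxr bform_mulmxl !mulmxA.
have pullpsd l (M : 'M[R]_l) (K : 'M[R]_(l, k + m)) :
    nonneg_symmetric M -> nonneg_symmetric (K^T *m M *m K).
  by move=> /(nonneg_symmetric_congr K^T); rewrite trmxK.
have trE : \tr (Q *m (Z^T *m G *m Z)) = \tr (Z *m Q *m Z^T *m G).
  by rewrite !mulmxA mxtrace_mulC !mulmxA.
have prodE M x : bform ((Z^T *m M *m Z) *m Q *m (Z^T *m G *m Z)) x x =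
    bform (M *m (Z *m Q *m Z^T) *m G) (Z *m x) (Z *m x).
  by rewrite -pull !mulmxA.
have driftE l (M : 'M[R]_l) (K : 'M[R]_(l, k + m)) (A : 'M[R]_l) x : K *m B = A *m K ->
    bform (K^T *m M *m K) x (B *m x) = bform M (K *m x) (A *m (K *m x)).
  by move=> KB; rewrite pull !mulmxA KB.
have y0 x := bform_ge0 psdH (Y *m x); have z0 x := bform_ge0 psdG (Z *m x).
exists (Z^T *m G *m Z), (Z^T *m C *m Z), (Y^T *m H *m Y), (kz + kp * (kz + ky)), delta.
have kk : kz <= kz + kp * (kz + ky) by rewrite lerDl mulr_ge0 // addr_ge0.
split=> //; try exact: pullpsd.
- by rewrite !trmx_mul trmxK sC mulmxA.
- by apply: le_trans kk.
- by move=> x; rewrite (driftE _ _ _ _ _ ZB).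
- by move=> x; rewrite trE prodE (driftE _ _ _ _ _ ZB) pull; exact: nn.
- by move=> x; rewrite !pull; apply: le_trans (cb _) _; exact: ler_wpM2r.
- by move=> x; rewrite prodE pull; apply: le_trans (cn _) _; exact: ler_wpM2r.
- by move=> x; rewrite (driftE _ _ _ _ _ YB) pull; exact: sd.
- move=> x; rewrite !pull.
  have -> : bform 1%:M x x = bform ((invmx P)^T *m invmx P) (P *m x) (P *m x).
    by rewrite bform_mulmxl bform_mulmxr -!mulmxA mulVmx // mulmx1 -trmx_mul mulVmx // trmx1.
  have nP : bform 1%:M (P *m x) (P *m x) =
      bform 1%:M (Y *m x) (Y *m x) + bform 1%:M (Z *m x) (Z *m x).
    by rewrite PE mul_col_mx /bform !mulmx1 tr_col_mx mul_row_col mxE.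
  apply: le_trans (ler_norm _) _; apply: le_trans (kpP _) _; rewrite nP.
  have h1 := sk (Y *m x); have h2 := nk (Z *m x).
  have h3 : bform 1%:M (Y *m x) (Y *m x) + bform 1%:M (Z *m x) (Z *m x) <=
    (kz + ky) * (bform G (Z *m x) (Z *m x) + bform H (Y *m x) (Y *m x)).
    have := mulr_ge0 kz0 (y0 x); have := mulr_ge0 ky0 (z0 x); lra.
  have := ler_wpM2l kp0 h3.
  have := mulr_ge0 kz0 (addr_ge0 (z0 x) (y0 x)); lra.
- by rewrite trE; case: nondeg => [|h]; [left | right=> x; rewrite pull].
Qed.

End JordanForms.

(** * Controllability by polynomial paths *)

Section ControlledPaths.
Variable R : realType.
Variable n : nat.
Local Notation N := n.+1.
Local Notation pvec := ('cV[{poly R}]_N).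
Implicit Types (p q r : pvec) (a : R) (M : nat -> 'M[R]_N).

Definition pderiv p : pvec := map_mx (@deriv R) p.
Definition peval a p : 'cV[R]_N := map_mx (horner^~ a) p.
Definition pmul (A : 'M[R]_N) p : pvec := map_mx polyC A *m p.

Lemma pderivD p q : pderiv (p + q) = pderiv p + pderiv q.
Proof. by apply/matrixP => i j; rewrite !mxE derivD. Qed.

Lemma pderiv_sum (I : Type) (s : seq I) (F : I -> pvec) :
  pderiv (\sum_(i <- s) F i) = \sum_(i <- s) pderiv (F i).
Proof.
elim: s => [|i s IH]; last by rewrite !big_cons pderivD IH.
by rewrite !big_nil; apply/matrixP => i j; rewrite !mxE deriv0.
Qed.

Lemma pderiv_mul A p : pderiv (pmul A p) = pmul A (pderiv p).
Proof.
apply/matrixP => i j; rewrite !mxE linear_sum /=; apply: eq_bigr => l _.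
by rewrite !mxE derivM derivC mul0r add0r.
Qed.

Lemma pderivZ (c : {poly R}) p : pderiv (c *: p) = c^`() *: p + c *: pderiv p.
Proof. by apply/matrixP => i j; rewrite !mxE derivM. Qed.

Lemma pevalD a p q : peval a (p + q) = peval a p + peval a q.
Proof. by apply/matrixP => i j; rewrite !mxE hornerD. Qed.

Lemma pevalN a p : peval a (- p) = - peval a p.
Proof. by apply/matrixP => i j; rewrite !mxE hornerN. Qed.

Lemma pevalZ a (c : {poly R}) p : peval a (c *: p) = c.[a] *: peval a p.
Proof. by apply/matrixP => i j; rewrite !mxE hornerM. Qed.

Lemma peval_sum a (I : Type) (s : seq I) (F : I -> pvec) :
  peval a (\sum_(i <- s) F i) = \sum_(i <- s) peval a (F i).
Proof.
elim: s => [|i s IH]; last by rewrite !big_cons pevalD IH.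
by rewrite !big_nil; apply/matrixP => i j; rewrite !mxE horner0.
Qed.

Lemma peval_mul a A p : peval a (pmul A p) = A *m peval a p.
Proof.
apply/matrixP => i j; rewrite !mxE horner_sum; apply: eq_bigr => l _.
by rewrite !mxE hornerM hornerC.
Qed.

Lemma pmulD A p q : pmul A (p + q) = pmul A p + pmul A q.
Proof. exact: mulmxDr. Qed.

Lemma pmulN A p : pmul A (- p) = - pmul A p.
Proof. exact: mulmxN. Qed.

Lemma pmulZ A (c : {poly R}) p : pmul A (c *: p) = c *: pmul A p.
Proof. by rewrite /pmul -scalemxAr. Qed.

Lemma pmul_mulmx A A' p : pmul A (pmul A' p) = pmul (A *m A') p.
Proof. by rewrite /pmul mulmxA -map_mxM. Qed.

Lemma pmul_suml (I : Type) (s : seq I) (F : I -> 'M[R]_N) p :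
  pmul (\sum_(i <- s) F i) p = \sum_(i <- s) pmul (F i) p.
Proof. by rewrite /pmul map_mx_sum mulmx_suml. Qed.

(** The coefficients of the path are determined by the last one, [p], through this
    recursion, whose term of index [i] is [(-1)^i] times the [i]-th derivative of [p]
    up to derivatives of lower order. *)
Fixpoint path_coeff M i p : pvec :=
  if i is i'.+1 then - (pderiv (path_coeff M i' p) + pmul (M (n - i')%N) p) else p.

Lemma path_coeffD M i p q :
  path_coeff M i (p + q) = path_coeff M i p + path_coeff M i q.
Proof.
elim: i => //= i ->; rewrite pderivD pmulD -opprD; congr (- _).
by rewrite addrACA.
Qed.

(** The recursion lowers the order of vanishing at [a] by at most one in each step, and
    the leading coefficient picks up a non-zero factor. *)
Lemma path_coeff_order M a i q j : (j <= i)%N -> exists2 r,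
  path_coeff M j (('X - a%:P) ^+ i *: q) = ('X - a%:P) ^+ (i - j) *: r &
  peval a r = ((-1) ^+ j * (i ^_ j)%:R) *: peval a q.
Proof.
elim: j => [|j IH] ji.
  by exists q; rewrite ?subn0 // expr0 ffactn0 mulr1 scale1r.
have [r rE ra] := IH (ltnW ji).
exists (- ((i - j)%:R *: r + ('X - a%:P) *: pderiv r
           + ('X - a%:P) ^+ j.+1 *: pmul (M (n - j)%N) q)).
  rewrite /= rE pderivZ pmulZ scalerN; congr (- _).
  have ij : (i - j)%N = (i - j.+1).+1 by rewrite subnSK.
  rewrite !scalerDr !scalerA -exprD subnK // -exprSr -ij; congr (_ + _ + _).
  rewrite deriv_exp derivXsubC mul1r ij -mulr_natr /=; congr (_ *: _).
rewrite pevalN !pevalD !pevalZ ra hornerXsubC subrr scale0r horner_exp hornerXsubC subrr.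
rewrite expr0n /= scale0r !addr0 scalerA -scaleNr; congr (_ *: _).
by rewrite -(rmorph_nat polyC) hornerC ffactnSr natrM exprS; ring.
Qed.

(** The values at [a] are prescribed one after the other: adding a multiple of
    [(X - a)^(i+1)] changes the value of index [i + 1] and none of the previous ones. *)
Lemma path_coeff_jet M a (eta : nat -> 'cV[R]_N) i : exists p,
  forall j, (j <= i)%N -> peval a (path_coeff M j p) = eta j.
Proof.
elim: i => [|i [p pE]].
  exists (map_mx polyC (eta 0%N)) => j; rewrite leqn0 => /eqP -> /=.
  by apply/matrixP => k l; rewrite !mxE hornerC.
pose c : R := (-1) ^+ i.+1 * (i.+1 ^_ i.+1)%:R.
have c0 : c != 0 by rewrite mulf_neq0 ?signr_eq0 // pnatr_eq0 ffactnn -lt0n fact_gt0.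
pose x := c^-1 *: (eta i.+1 - peval a (path_coeff M i.+1 p)).
pose q := ('X - a%:P) ^+ i.+1 *: (map_mx polyC x : pvec).
have qx : peval a (map_mx polyC x) = x by apply/matrixP => k l; rewrite !mxE hornerC.
exists (p + q) => j; rewrite leq_eqVlt => /orP[/eqP ->|ji]; rewrite path_coeffD pevalD.
  have [r -> ra] := path_coeff_order M a (map_mx polyC x) (leqnn i.+1).
  by rewrite subnn expr0 scale1r ra qx /x scalerA divff // scale1r addrC subrK.
have [r -> _] := path_coeff_order M a (map_mx polyC x) (ltnW ji).
rewrite pevalZ horner_exp hornerXsubC subrr expr0n subn_eq0 ltnNge -ltnS ji scale0r addr0.
by rewrite pE.
Qed.

(** Polynomials solving the two problems separately are glued by the Chinese remainder
    theorem, with the moduli [X^N] and [(X - T)^N]. *)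
Lemma path_coeff_two_jets M (T : R) (eta0 etaT : nat -> 'cV[R]_N) : T != 0 ->
  exists p, forall j, (j <= n)%N ->
    peval 0 (path_coeff M j p) = eta0 j /\ peval T (path_coeff M j p) = etaT j.
Proof.
move=> T0.
have [p0 p0E] := path_coeff_jet M 0 eta0 n; have [pT pTE] := path_coeff_jet M T etaT n.
have cop : coprimep (('X - 0%:P) ^+ N : {poly R}) (('X - T%:P) ^+ N).
  apply/coprimep_expl/coprimep_expr.
  by rewrite coprimep_XsubC2 // subr_eq0.
have /Bezout_eq1_coprimepP [[u w] /= uw] := cop.
have glue (a b : R) (q q' : pvec) (c : {poly R}) j : (j <= n)%N ->
    peval a (path_coeff M j (q + ('X - a%:P) ^+ N *: (c *: q'))) = peval a (path_coeff M j q).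
  move=> jn; rewrite path_coeffD pevalD.
  have [r -> _] := path_coeff_order M a (c *: q') (leqW jn).
  by rewrite pevalZ horner_exp hornerXsubC subrr expr0n subn_eq0 ltnNge jn scale0r addr0.
exists (p0 + ('X - 0%:P) ^+ N *: (u *: (pT - p0))) => j jn; split.
  by rewrite glue // p0E.
have -> : p0 + ('X - 0%:P) ^+ N *: (u *: (pT - p0)) =
          pT + ('X - T%:P) ^+ N *: (w *: (p0 - pT)).
  rewrite !scalerA [_ * u]mulrC [_ * w]mulrC.
  have -> : u * ('X - 0%:P) ^+ N = 1 - w * ('X - T%:P) ^+ N by rewrite -uw addrK.
  rewrite scalerBl scale1r -[p0 - pT]opprB scalerN addrA [p0 + _]addrC subrK.
  by [].
by rewrite glue // pTE.
Qed.

Variables Q B : 'M[R]_N.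

Lemma kalman_span k (X : 'M[R]_(N, k)) : \rank (kalman_mx Q B) = N ->
  exists M : nat -> 'M[R]_(N, k), X = \sum_(i < N) B ^+ i *m Q *m M i.
Proof.
move=> rk; have /row_freeP [K KE] : row_free (kalman_mx Q B) by rewrite /row_free rk.
exists (fun i => submxcol (K *m X) (inord i)).
rewrite -[LHS]mul1mx -KE -mulmxA -[K *m X in LHS]submxcolK /kalman_mx mul_mxrow_mxcol.
by apply: eq_bigr => i _; rewrite inord_val.
Qed.

(** Controllability by polynomials: along [sum_k B^k Q c_k] the drift is compensated
    up to a vector of the range of [Q] if the coefficients satisfy the recursion of
    [path_coeff], where the matrices [M_k] express [B^N Q] in terms of the lower
    powers; two Hermite interpolation conditions prescribe the end points. *)
Lemma controlled_path (T : R) (x y : 'cV[R]_N) : T != 0 ->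
  \rank (kalman_mx Q B) = N ->
  exists gam w : pvec, [/\ pderiv gam = - pmul B gam + pmul Q w,
    peval 0 gam = x & peval T gam = y].
Proof.
move=> T0 rk.
have [M ME] := kalman_span (B ^+ N *m Q) rk.
have [cx xE] := kalman_span x rk; have [cy yE] := kalman_span y rk.
have [p pE] := path_coeff_two_jets M (fun j => cx (n - j)%N) (fun j => cy (n - j)%N) T0.
pose d j := path_coeff M j p.
pose gam := \sum_(k < N) pmul (B ^+ k *m Q) (d (n - k)%N).
have kn (k : 'I_N) : (k <= n)%N by rewrite -ltnS.
exists gam, (- d N); split; first last.
- rewrite peval_sum yE; apply: eq_bigr => k _.
  by rewrite peval_mul; have [_ ->] := pE (n - k)%N (leq_subr _ _); rewrite subKn.
- rewrite peval_sum xE; apply: eq_bigr => k _.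
  by rewrite peval_mul; have [-> _] := pE (n - k)%N (leq_subr _ _); rewrite subKn.
apply/eqP; rewrite addrC -subr_eq opprK; apply/eqP.
pose f k := pmul (B ^+ k *m Q) (d (N - k)%N).
have dE (k : 'I_N) : pderiv (d (n - k)%N) = - d (N - k)%N - pmul (M k) p.
  by rewrite (subSn (kn k)) /d /= (subKn (kn k)) opprK addrK.
have -> : pderiv gam = - (\sum_(k < N) f k) - pmul (B ^+ N *m Q) p.
  rewrite /gam pderiv_sum ME pmul_suml -!sumrN -big_split /=; apply: eq_bigr => k _.
  by rewrite pderiv_mul dE pmulD !pmulN pmul_mulmx.
have -> : pmul B gam = \sum_(k < N) f k.+1.
  rewrite /gam /pmul mulmx_sumr; apply: eq_bigr => k _.
  by rewrite -!/(pmul _ _) pmul_mulmx mulmxA mulmxE -exprS /f subSS.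
have -> : \sum_(k < N) f k.+1 = f N - f 0%N + \sum_(k < N) f k.
  by rewrite -(telescope_sumr f (leq0n N)) big_mkord -big_split /=;
     apply: eq_bigr => k _; rewrite subrK.
have fN : f N = pmul (B ^+ N *m Q) p by rewrite /f subnn.
have f0 : f 0%N = pmul Q (d N) by rewrite /f subn0 expr0 mul1mx.
by rewrite -fN f0 addrC addrA addrK addrAC subrr add0r pmulN.
Qed.

End ControlledPaths.

(** * The strong minimum principle *)

Section StrongMinimum.
Variable R : realType.

(** One-sided, because the minimum over a time interval may be attained at its final
    time. *)
Lemma derive_left_min (f : R -> R) (l t0 : R) : 0 < t0 -> is_derive t0 1 f l ->
  (forall t, 0 <= t -> t <= t0 -> f t0 <= f t) -> l <= 0.
Proof.
move=> t00 df fmin; rewrite leNgt; apply/negP => l0.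
have : (fun k : R => k^-1 *: ((f \o shift t0) (k *: 1) - f t0)) @ 0^' --> l.
  by case: df => + <-.
move=> /cvgrPdist_lt /(_ _ l0) [r /= r0 Hr].
pose k := - (Num.min r t0 / 2).
have m0 : 0 < Num.min r t0 by rewrite lt_min r0.
have k0 : k < 0 by rewrite /k; lra.
have [mr mt] : Num.min r t0 <= r /\ Num.min r t0 <= t0 by rewrite !ge_min !lexx orbT.
have kr : Num.min r t0 / 2 < r by lra.
have := Hr k; rewrite /= sub0r normrN ltr0_norm // {1}/k opprK => /(_ kr).
rewrite lt_eqF // => /(_ isT); rewrite [k *: 1]mulr1 /GRing.scale /= ltr_norml => /andP[_ h].
have : f t0 <= f (k + t0) by apply: fmin; rewrite /k; lra.
move=> h1; have : k^-1 * (f (k + t0) - f t0) <= 0.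
  by apply: mulr_le0_ge0; rewrite ?invr_le0 ?subr_ge0 // ltW.
lra.
Qed.

Variable n : nat.
Local Notation N := n.+1.
Variables (S : seq 'cV[R]_N) (B : 'M[R]_N).
Local Notation Q := (dyad_sum S).
Local Notation sqn x := (bform 1%:M x x).

(** The Gaussian touches at height [E] above the constant [k]; division by [E] leaves an
    inequality between derivatives of its exponent. *)
Lemma gaussian_touching (v : 'cV[R]_N -> R) (c k E : R) (x g : 'cV[R]_N) :
  is_C2 v -> OU_operator Q B v x <= 0 -> 0 < E -> v x = k + E ->
  (forall y, k + E * expR (- (c / 2 * (sqn (y - g) - sqn (x - g)))) <= v y) ->
  2^-1 * c ^+ 2 * bform Q (x - g) (x - g) - 2^-1 * c * \tr Q - c * bform B (x - g) x <= 0.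
Proof.
move=> C2v sv E0 vx touch; set z := x - g.
pose phi y := E * expR (- (c / 2 * (sqn (y - g) - sqn z))).
have tphi y : v x - phi x <= v y - phi y.
  rewrite /phi -/z subrr mulr0 oppr0 expR0 mulr1 vx addrK.
  by have := touch y; rewrite -/z; lra.
pose p (d : 'cV[R]_N) := - (c * bform 1%:M z d) : R.
have jphi d : jet2 (fun t => phi (x + t *: d)) (E * p d) (E * (p d ^+ 2 - c * sqn d)).
  pose f t := 0 + p d * t + (- (c / 2 * sqn d)) * t ^+ 2 : R.
  have jf : jet2 f (p d) (2 * - (c / 2 * sqn d)) by exact: jet2_quad.
  have je := jet2_comp jf (fun t => is_derive_expR (f t)) (is_derive_expR (f 0)).
  have -> : (fun t => phi (x + t *: d)) = (fun t => E * expR (f t)).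
    apply/funext => t; rewrite /phi /f /p; congr (_ * expR _).
    have -> : x + t *: d - g = z + t *: d by rewrite /z addrAC.
    by rewrite bform_line ?trmx1 //; field.
  have f0 : f 0 = 0 by rewrite /f mulr0 expr0n /= mulr0 !addr0.
  apply: jet2_eq (jet2M (jet2_cst E) je) _ _; rewrite f0 expR0; first by ring.
  by field.
have := le_trans (OU_touching S B C2v tphi jphi) sv.
have -> : \sum_(s <- S) E * (p s ^+ 2 - c * sqn s) = E * (c ^+ 2 * bform Q z z - c * \tr Q).
  rewrite -mulr_sumr big_split /= sumrN -mulr_sumr sum_bform_diag mulmx1; congr (_ * (_ - _)).
  rewrite -[X in bform X]mulmx1 -[X in bform (X *m _)]mul1mx -[X in bform (_ *m X)]trmx1.
  rewrite -sum_bform_dyads mulr_sumr; apply: eq_bigr => s _; rewrite /p; ring.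
have -> : p (B *m x) = - (c * bform B z x) by rewrite /p bform_mulmxr mul1mx.
have -> : 2^-1 * (E * (c ^+ 2 * bform Q z z - c * \tr Q)) + E * - (c * bform B z x) =
  E * (2^-1 * c ^+ 2 * bform Q z z - 2^-1 * c * \tr Q - c * bform B z x) by ring.
by rewrite pmulr_rle0.
Qed.

Lemma peval_sqdist (gam : 'cV[{poly R}]_N) (x : 'cV[R]_N) (t : R) :
  is_derive t 1 (fun s => sqn (x - peval s gam))
    (- 2 * bform 1%:M (x - peval t gam) (peval t (pderiv gam))).
Proof.
pose P := \sum_i ((x i 0)%:P - gam i 0) ^+ 2 : {poly R}.
have -> : (fun s => sqn (x - peval s gam)) = horner P.
  apply/funext => s; rewrite /bform mulmx1 mxE horner_sum; apply: eq_bigr => i _.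
  by rewrite !mxE horner_exp hornerD hornerN hornerC expr2.
apply: is_derive_eq; rewrite /P linear_sum /= horner_sum /bform mulmx1 mxE mulr_sumr.
apply: eq_bigr => i _; rewrite !mxE expr2 derivM derivB derivC !hornerE /=; ring.
Qed.

(** The barrier is the exponential of the opposite: a Gaussian with its center on the
    path, which becomes narrower and lower with time. *)
Definition barrier_exponent (lam b kap : R) (gam : 'cV[{poly R}]_N) (t : R) (x : 'cV[R]_N) : R :=
  lam * (1 + 4 * b * t) / 2 * sqn (x - peval t gam) + kap * t.

Lemma barrier_exponent_derive lam b kap gam (t : R) x :
  is_derive t 1 (fun s => barrier_exponent lam b kap gam s x)
   (2 * lam * b * sqn (x - peval t gam)
    - lam * (1 + 4 * b * t) * bform 1%:M (x - peval t gam) (peval t (pderiv gam)) + kap).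
Proof.
have d := is_deriveD (is_deriveM (is_derive_affine (lam / 2) (2 * lam * b) t)
   (peval_sqdist gam x t)) (is_derive_affine 0 kap t).
have -> : (fun s => barrier_exponent lam b kap gam s x) =
  ((fun s => lam / 2 + 2 * lam * b * s) * (fun s => sqn (x - peval s gam))
   + (fun s => 0 + kap * s))%R.
  by apply/funext => s; rewrite !fctE /barrier_exponent; field.
by apply: is_derive_eq d _; rewrite /GRing.scale /=; field.
Qed.

(** No interior minimum of [(v - k) * exp (barrier_exponent)]: the constant [kap] pays
    for the noise and for the energy [<Q w, w>] of the control, and the growth of the
    factor [1 + 4 b t] pays for the drift relative to the path. *)
Lemma barrier_no_interior_min (v : 'cV[R]_N -> R) (lam b k t : R) gam w x :
  nonneg_symmetric Q -> is_C2 v -> OU_operator Q B v x <= 0 ->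
  pderiv gam = - pmul B gam + pmul Q w ->
  (forall y, `|bform B y y| <= b * sqn y) -> 0 < lam -> 0 <= b ->
  0 < t -> 4 * b * t <= 1 -> k < v x ->
  let kap := lam * \tr Q + 2^-1 * bform Q (peval t w) (peval t w) in
  forall kap', kap < kap' ->
  (forall y, (v x - k) * expR (barrier_exponent lam b kap' gam t x) <=
             (v y - k) * expR (barrier_exponent lam b kap' gam t y)) ->
  (forall s, 0 <= s -> s <= t -> (v x - k) * expR (barrier_exponent lam b kap' gam t x) <=
             (v x - k) * expR (barrier_exponent lam b kap' gam s x)) -> False.
Proof.
move=> psdQ C2v sv path bP lam0 b0 t0 bt vx kap kap' kk ymin smin.
have E0 : 0 < v x - k by rewrite subr_gt0.
set g := peval t gam; set z := x - g; pose c := lam * (1 + 4 * b * t).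
have bt0 : 0 <= 4 * b * t by rewrite mulr_ge0 ?mulr_ge0 // ltW.
have c0 : 0 < c by rewrite mulr_gt0 //; lra.
have T1 : 2^-1 * c ^+ 2 * bform Q z z - 2^-1 * c * \tr Q - c * bform B z x <= 0.
  apply: (gaussian_touching (k := k) C2v sv E0); first by rewrite addrC subrK.
  move=> y; rewrite -lerBrDl.
  have := ymin y; rewrite /barrier_exponent -/g -/c -/z.
  rewrite -ler_pdivrMr ?expR_gt0 // => h; apply: le_trans h.
  rewrite -[leRHS]mulrA ler_pM2l // -expRN -expRD ler_expR; lra.
have T2 : 2 * lam * b * sqn z - c * bform 1%:M z (peval t (pderiv gam)) + kap' <= 0.
  apply: derive_left_min t0 (barrier_exponent_derive lam b kap' gam t x) _.
  by move=> s s0 st; have := smin s s0 st; rewrite ler_pM2l // ler_expR.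
have zx : x = z + g by rewrite /z subrK.
clearbody z.
have dg : bform 1%:M z (peval t (pderiv gam)) = - bform B z g + bform Q z (peval t w).
  by rewrite path pevalD pevalN !peval_mul bformDr bformNr !bform_mulmxr !mul1mx.
have T3 := bform_ge0 psdQ (c *: z - peval t w).
have Qsym := bform_sym psdQ.
move: T3; rewrite !(bformDl, bformDr, bformNl, bformNr, bformZl, bformZr) (Qsym (peval t w) z).
have T4 : bform B z x = bform B z z + bform B z g.
  by rewrite [in LHS]zx bformDr.
have T5 : c * bform B z z <= 2 * lam * b * sqn z.
  have h1 := ler_norm (bform B z z); have h2 := bP z.
  have s0 := bform1_ge0 z.
  have h3 : c * bform B z z <= c * (b * sqn z) by rewrite ler_pM2l //; lra.
  have h4 : c * (b * sqn z) <= 2 * lam * (b * sqn z).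
    by apply: ler_wpM2r; [exact: mulr_ge0 | rewrite /c [2 * lam]mulrC ler_pM2l //; lra].
  lra.
have T6 : 2^-1 * c * \tr Q <= lam * \tr Q.
  apply: ler_wpM2r; first by case: (nonneg_symmetric_tr psdQ).
  have : c <= lam * 2 by rewrite /c ler_pM2l //; lra.
  lra.
move: T1 T2 kk; rewrite /kap dg T4; nra.
Qed.

End StrongMinimum.

Section StrongMinimumPrinciple.
Variable R : realType.
Variable n : nat.
Local Notation N := n.+1.
Variables (S : seq 'cV[R]_N) (B : 'M[R]_N).
Local Notation Q := (dyad_sum S).
Local Notation sqn x := (bform 1%:M x x).

Lemma peval_coord_continuous (p : 'cV[{poly R}]_N) i :
  continuous (fun t : R => peval t p i 0).
Proof.
move=> t; have -> : (fun t : R => peval t p i 0) = horner (p i 0).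
  by apply/funext => s; rewrite mxE.
exact: continuous_horner.
Qed.

Lemma peval_bform_bounded (M : 'M[R]_N) (p : 'cV[{poly R}]_N) (T : R) : 0 <= T ->
  exists K, forall t, 0 <= t -> t <= T -> bform M (peval t p) (peval t p) <= K.
Proof.
move=> T0.
have [|c _ cmax] := @EVT_max R (fun t => bform M (peval t p) (peval t p)) 0 T T0.
  by apply: continuous_subspaceT; apply: continuous_bform => i; exact: peval_coord_continuous.
exists (bform M (peval c p) (peval c p)) => t t0 tT.
by apply: cmax; rewrite in_itv /= t0.
Qed.

Lemma barrier_continuous (v : 'cV[R]_N -> R) (lam b kap k : R) gam : continuous v ->
  continuous (fun tx : R * 'cV[R]_N =>
    (v tx.2 - k) * expR (barrier_exponent lam b kap gam tx.1 tx.2)).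
Proof.
move=> cv.
have c1 : continuous (fun tx : R * 'cV[R]_N => tx.1) by move=> tx; exact: cvg_fst.
have c2 : continuous (fun tx : R * 'cV[R]_N => tx.2) by move=> tx; exact: cvg_snd.
have csq : continuous (fun tx : R * 'cV[R]_N => sqn (tx.2 - peval tx.1 gam)).
  have cc i : continuous (fun tx : R * 'cV[R]_N => (tx.2 - peval tx.1 gam) i 0).
    have -> : (fun tx : R * 'cV[R]_N => (tx.2 - peval tx.1 gam) i 0) =
              (fun tx => tx.2 i 0 - (gam i 0).[tx.1]).
      by apply/funext => tx; rewrite !mxE.
    move=> tx; apply: (@continuousB _ _ _ (fun tx : R * 'cV[R]_N => tx.2 i 0)
       (fun tx : R * 'cV[R]_N => (gam i 0).[tx.1])).
      apply: (@continuous_comp _ _ _ (fun tx : R * 'cV[R]_N => tx.2)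
        (fun x : 'cV[R]_N => x i 0)); [exact: c2 | exact: coord_continuous].
    apply: (@continuous_comp _ _ _ (fun tx : R * 'cV[R]_N => tx.1) (horner (gam i 0))).
      exact: c1.
    exact: continuous_horner.
  exact: continuous_bform.
move=> tx.
have cu : {for tx, continuous (fun tx : R * 'cV[R]_N => v tx.2 - k)}.
  apply: (@continuousB _ _ _ (fun tx : R * 'cV[R]_N => v tx.2) (cst k)).
    by apply: (@continuous_comp _ _ _ (fun tx : R * 'cV[R]_N => tx.2) v); [exact: c2 | exact: cv].
  exact: cst_continuous.
apply: (continuousM cu).
apply: (@continuous_comp _ _ _ (fun tx : R * 'cV[R]_N => barrier_exponent lam b kap gam tx.1 tx.2) expR);
  last exact: continuous_expR.
have lin (c d : R) : {for tx, continuous (fun tx : R * 'cV[R]_N => c + d * tx.1)}.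
  apply: (@continuousD _ _ _ (cst c) (fun tx : R * 'cV[R]_N => d * tx.1)).
    exact: cst_continuous.
  apply: (@continuousM _ _ (cst d) (fun tx : R * 'cV[R]_N => tx.1)); last exact: c1.
  exact: cst_continuous.
have -> : (fun tx : R * 'cV[R]_N => barrier_exponent lam b kap gam tx.1 tx.2) =
  (fun tx => (lam / 2 + 2 * lam * b * tx.1) * sqn (tx.2 - peval tx.1 gam) + (0 + kap * tx.1)).
  by apply/funext => s; rewrite /barrier_exponent; field.
apply: continuousD (lin _ _); exact: continuousM (lin _ _) (csq tx).
Qed.

(** The strong minimum principle. A point with a value above the minimum is steered
    to the minimum point in a time so short that the barrier, started inside the
    region of large values, is still positive on arrival. *)
Lemma strong_minimum_principle (v : 'cV[R]_N -> R) x0 :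
  nonneg_symmetric Q -> \rank (kalman_mx Q B) = N -> is_C2 v ->
  (forall x, OU_operator Q B v x <= 0) -> (forall x, v x0 <= v x) ->
  forall y, v y = v x0.
Proof.
move=> psdQ rk C2v sv vmin y; apply/eqP; rewrite eq_le vmin andbT leNgt.
apply/negP => vy; set m := v x0 in vmin vy *.
pose h0 := (v y - m) / 2; have h00 : 0 < h0 by rewrite /h0; lra.
have cv : continuous v by case: C2v => -[].
have := cv y => /cvgrPdist_lt /(_ _ h00) /nbhs_ballP [r /= r0 Hr].
have near_y x : sqn (x - y) < r ^+ 2 -> m + h0 < v x.
  move=> xy; have : `|v y - v x| < h0.
    apply: Hr; split => // i j; rewrite ord1 /ball /= -ltr_sqr ?nnegrE ?(ltW r0) //.
    apply: le_lt_trans xy; rewrite real_normK ?num_real //.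
    rewrite /bform mulmx1 mxE (bigD1 i) //= !mxE -expr2.
    rewrite -[leLHS]addr0 lerD //; first by rewrite -sqrrN opprB.
    by apply: sumr_ge0 => l _; rewrite mxE -expr2 sqr_ge0.
  by rewrite ltr_norml /h0 => /andP[_]; lra.
have r20 : 0 < r ^+ 2 by rewrite exprn_gt0.
have [b b0 bP] := bform_bound B.
have [trQ0 _] := nonneg_symmetric_tr psdQ.
(* [T = 1 / D] satisfies both [4 b T <= 1] and [4 tr Q T <= r^2]. *)
pose D := 4 * b + 1 + 4 * \tr Q / r ^+ 2.
have q0 : 0 <= \tr Q / r ^+ 2 by rewrite divr_ge0 // ltW.
have D0 : 0 < D by rewrite /D -mulrA; lra.
pose T := D^-1; have T0 : 0 < T by rewrite invr_gt0.
have TD : T * D = 1 by rewrite mulVf // gt_eqF.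
have bT : 4 * b * T <= 1.
  by rewrite -[leRHS]TD mulrC ler_pM2l // /D -[4 * _ / _]mulrA; lra.
have trT : 4 * \tr Q * T <= r ^+ 2.
  have -> : 4 * \tr Q * T = T * (4 * \tr Q / r ^+ 2) * r ^+ 2 by field; rewrite gt_eqF.
  rewrite -[leRHS]mul1r ler_pM2r // -[leRHS]TD ler_pM2l // /D; lra.
have Tn0 : T != 0 by rewrite gt_eqF.
have [gam [w [path gam0 gamT]]] := controlled_path y x0 Tn0 rk.
have [Gm GP] := peval_bform_bounded 1%:M gam (ltW T0).
have [Wm WP] := peval_bform_bounded Q w (ltW T0).
have Wm0 : 0 <= Wm by apply: le_trans (WP 0 _ _); rewrite ?bform_ge0 // ltW.
pose c := 2^-1 * Wm + 1; have c0 : 0 < c by rewrite /c; lra.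
(* For this [lam] the cost [c T] of the path is less than [lam r^2 / 4], and the choice
   of [T] bounds the cost of the noise by the same quantity. *)
pose lam := 4 * (c * T) / r ^+ 2 + 1.
have cT0 : 0 < c * T by rewrite mulr_gt0.
have lam0 : 0 < lam.
  by have : 0 < 4 * (c * T) / r ^+ 2; [apply: divr_gt0 => //; lra | rewrite /lam; lra].
have lamE : lam * r ^+ 2 / 4 = c * T + r ^+ 2 / 4 by rewrite /lam; field; rewrite gt_eqF.
pose kap := lam * \tr Q + c.
have kap0 : 0 <= kap by rewrite /kap; have := mulr_ge0 (ltW lam0) trQ0; lra.
have kapT : kap * T < lam * r ^+ 2 / 2.
  have := ler_wpM2l (ltW lam0) trT; rewrite /kap.
  have -> : lam * (4 * \tr Q * T) = 4 * (lam * \tr Q * T) by ring.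
  by rewrite mulrDl; lra.
(* [eps] is the value at distance [r] and time 0 of the Gaussian of height [h0]. *)
pose eps := h0 * expR (- (lam * r ^+ 2 / 2)).
have eps0 : 0 < eps by rewrite mulr_gt0 // expR_gt0.
pose k := m - eps.
have vk x : eps <= v x - k by rewrite /k; have := vmin x; lra.
pose F t x := (v x - k) * expR (barrier_exponent lam b kap gam t x).
have bar_ge t x : 0 <= t -> lam / 2 * sqn (x - peval t gam) <= barrier_exponent lam b kap gam t x.
  move=> t0; rewrite /barrier_exponent.
  have h1 := mulr_ge0 kap0 t0.
  have h2 : 0 <= lam * b * t * sqn (x - peval t gam).
    by rewrite mulr_ge0 ?bform1_ge0 // mulr_ge0 // mulr_ge0 // ltW.
  have -> : lam * (1 + 4 * b * t) / 2 * sqn (x - peval t gam) =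
    lam / 2 * sqn (x - peval t gam) + 2 * (lam * b * t * sqn (x - peval t gam)) by field.
  lra.
have far t x : 0 <= t -> r ^+ 2 <= sqn (x - peval t gam) -> h0 <= F t x.
  move=> t0 rx; have -> : h0 = eps * expR (lam * r ^+ 2 / 2).
    by rewrite /eps -mulrA -expRD addNr expR0 mulr1.
  apply: ler_pM; [exact: ltW | exact: expR_ge0 | exact: vk | ].
  rewrite ler_expR; apply: le_trans (bar_ge t x t0).
  by rewrite mulrAC ler_pM2l // divr_gt0.
have bnd t x : 0 <= t -> t <= T -> F t x < h0 -> sqn x <= 2 * r ^+ 2 + 2 * Gm.
  move=> t0 tT Fx; have : sqn (x - peval t gam) < r ^+ 2.
    by rewrite ltNge; apply/negP => /(far t x t0); lra.
  have := GP t t0 tT; set g := peval t gam; set z := x - g.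
  have zx : x = z + g by rewrite /z subrK.
  clearbody z; rewrite zx; have := bform1_ge0 (z - g).
  rewrite !(bformDl, bformDr, bformNl, bformNr) [bform _ g z]bform_tr trmx1; lra.
pose A := `[0, T]%classic `*` [set x : 'cV[R]_N | sqn x <= 2 * r ^+ 2 + 2 * Gm].
have FT : F T x0 < h0.
  rewrite /F /barrier_exponent gamT subrr bform0l mulr0 add0r -/m /k opprB addrC subrK.
  rewrite /eps -mulrA -expRD -[ltRHS]mulr1 ltr_pM2l // -[ltRHS]expR0 ltr_expR; lra.
have AT : A (T, x0).
  by split; [rewrite /= in_itv /= lexx ltW | exact: (bnd T x0 (ltW T0) (lexx T) FT)].
have cA : compact A by apply: compact_setX; [exact: segment_compact | exact: compact_ball].
have [||[t x] tx Fmin] := @compact_EVT_min _ R (fun tx => F tx.1 tx.2) A _ cA.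
- by exists (T, x0).
- by apply: continuous_subspaceT; exact: barrier_continuous.
move: tx; rewrite inE => -[/=]; rewrite in_itv /= => /andP[t0 tT] xK.
have Ftx : F t x < h0 by apply: le_lt_trans FT; apply: (Fmin (T, x0)); rewrite inE.
have tn0 : 0 < t.
  rewrite lt_neqAle t0 andbT; apply/eqP => t00; move: Ftx; rewrite -t00 ltNge => /negP; apply.
  have [xy|xy] := ltP (sqn (x - y)) (r ^+ 2); last by apply: far; rewrite ?gam0.
  rewrite -[leLHS]mulr1; apply: ler_pM => //; first exact: ltW.
    by rewrite /k; have := near_y x xy; lra.
  rewrite -[leLHS]expR0 ler_expR; apply: le_trans (bar_ge 0 x _) => //.
  by rewrite mulr_ge0 ?bform1_ge0 // divr_ge0 // ltW.
apply: (@barrier_no_interior_min R n S B v lam b k t gam w x psdQ C2v (sv x) path bP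
   lam0 b0 tn0 _ _ kap).
- by apply: le_trans bT; rewrite ler_wpM2l // mulr_ge0.
- by have := vk x; lra.
- by rewrite /kap ltrD2l /c; have := WP t t0 tT; lra.
- move=> x'; have [Fx|Fx] := ltP (F t x') h0; last by apply: ltW; apply: lt_le_trans Fx.
  apply: (Fmin (t, x')); rewrite inE; split; first by rewrite /= in_itv /= t0.
  exact: bnd Fx.
- move=> s s0 st; apply: (Fmin (s, x)); rewrite inE; split => //.
  by rewrite /= in_itv /= s0 (le_trans st).
Qed.

End StrongMinimumPrinciple.

Theorem theorem6p1 (R : realType) (n : nat) (Q B : 'M[R]_n.+1)
    (v : 'cV[R]_n.+1 -> R) :
  nonneg_symmetric Q ->
  \rank (kalman_mx Q B) = n.+1 ->
  is_C2 v ->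
  (forall x, 0 <= v x) ->
  (forall x, OU_operator Q B v x <= 0) ->
  recurrent_Jordan B ->
  exists c : R, forall x, v x = c.
Proof.
move=> psdQ rk C2v v0 sv rec.
have [G [C [H [k [delta forms]]]]] := recurrent_Jordan_forms psdQ (kalman_mx_dual rk) rec.
have [S QS] := nonneg_symmetric_dyads psdQ; rewrite QS in psdQ rk sv forms.
have [W lyapW] := exists_lyapunov forms.
have [x0 x0min] := lyapunov_min lyapW C2v v0 sv.
by exists (v x0); exact: strong_minimum_principle psdQ rk C2v sv x0min.
Qed.
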